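(* Let $d,m\ge0$, $1\le k\le\ell$ and $0\le p\le\ell$ be integers. Let $\mathcal{A}^{p,k}_\ell(m,d)$ be the arrangement in $\mathbb{R}^\ell$ consisting of the hyperplanes: $x_i-x_j=0$ for $1\le i<j\le\ell$; $x_i-x_j=1$ for $1\le i<j\le\ell+1-k$; $x_i=s$ for $1\le i\le p$ and integers $1-\min\{\ell-i+1,k\}-m\le s\le d$; and $x_i=s$ for $p<i\le\ell$ and integers $-\min\{\ell-i+1,k\}-m\le s\le d$. Then the cone $\mathbf{c}\mathcal{A}^{p,k}_\ell(m,d)$ is ind-flag-accurate with exponents $1$, $(\ell+m+d)$ with multiplicity $p$, and $(\ell+m+d+1)$ with multiplicity $\ell-p$.
   Context: For an affine arrangement $\mathcal{A}$ in $\mathbb{R}^\ell$, its cone $\mathbf{c}\mathcal{A}$ is the central arrangement in $V'=\mathbb{R}^{\ell+1}$ (extra coordinate $z$) consisting of the hyperplanes $a_1x_1+\dots+a_\ell x_\ell=dz$ for each hyperplane $a_1x_1+\dots+a_\ell x_\ell=d$ of $\mathcal{A}$, together with $z=0$. For a central arrangement $\mathcal{A}$ in $W=\mathbb{R}^N$: $L(\mathcal{A})$ is the set of intersections of subsets of $\mathcal{A}$ (including $W$); $\mathcal{A}^X=\{H\cap X:H\in\mathcal{A},X\not\subseteq H\}$; $\mathcal{A}$ is free if $D(\mathcal{A})=\{\theta\in\mathrm{Der}(S):\theta(\alpha_H)\in\alpha_HS\ \forall H\}$ is free over $S=\mathbb{R}[x_1,\dots,x_N]$, exponents being degrees of a homogeneous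 basis. Inductively free arrangements: smallest class containing empty arrangements and containing $\mathcal{A}$ whenever some $H\in\mathcal{A}$ has $\mathcal{A}\setminus\{H\}$ and $\mathcal{A}^H$ in the class with $\exp(\mathcal{A}^H)\subseteq\exp(\mathcal{A}\setminus\{H\})$. $\mathcal{A}$, free with exponents $e_1\le\dots\le e_N$, is ind-flag-accurate if it is inductively free and there is a flag $X_1\subseteq\dots\subseteq X_N=W$ in $L(\mathcal{A})$ with $\dim X_d=d$ and each $\mathcal{A}^{X_d}$ inductively free with exponents $(e_1,\dots,e_d)$. *)

(* Defs.v *)
From HB Require Import structures.
From mathcomp Require Import all_boot all_order all_algebra.
From mathcomp Require Import finmap.
From mathcomp Require Import mpoly.
From mathcomp Require Import reals.

Set Implicit Arguments.
Unset Strict Implicit.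
Unset Printing Implicit Defensive.

Import Order.TTheory GRing.Theory Num.Theory.

Local Open Scope ring_scope.

(* A central arrangement is stored as the ambient subspace [space] of a fixed
   vector space together with the finite set [planes] of its hyperplanes,
   which are codimension-one subspaces of [space].  In this way the
   restriction A^X is literally the set of the H :&: X, with ambient space X;
   no identification of X with some R^n is chosen. *)
Record arrangement (R : fieldType) (V : vectType R) := Arrangement {
  space : {vspace V};
  planes : {fset {vspace V}}
}.

(* This property is not a field of [arrangement]: the cones below have it
   (lemma [cone_central]), and deletion and restriction preserve it. *)
Definition central_arrangement (R : fieldType) (V : vectType R)
    (A : arrangement V) : Prop :=
  forall H : {vspace V}, H \in planes A ->
    (H <= space A)%VS /\ (\dim H).+1 = \dim (space A).

Definition deletion (R : fieldType) (V : vectType R)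
    (A : arrangement V) (H : {vspace V}) : arrangement V :=
  Arrangement (space A) (planes A `\ H)%fset.

Definition restriction (R : fieldType) (V : vectType R)
    (A : arrangement V) (X : {vspace V}) : arrangement V :=
  Arrangement X
    [fset (H :&: X)%VS | H in [fset H in planes A | ~~ (X <= H)%VS]]%fset.

(* The intersection of the empty subset of the arrangement is the ambient
   space. *)
Definition in_lattice (R : fieldType) (V : vectType R)
    (A : arrangement V) (X : {vspace V}) : Prop :=
  exists2 B : {fset {vspace V}}, (B `<=` planes A)%fset &
    X = (space A :&: \bigcap_(H <- enum_fset B) H)%VS.

(* Given a basis b of an n-dimensional subspace X, the symmetric algebra S of
   the dual of X is {mpoly R[n]}, 'X_i being the i-th coordinate along b;
   [form_poly b phi] is the restriction to X of the linear form phi. *)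
Definition form_poly (R : fieldType) (V : vectType R) (n : nat)
    (b : n.-tuple V) (phi : 'Hom(V, R^o)) : {mpoly R[n]} :=
  \sum_(i < n) phi (tnth b i) *: 'X_i.

Definition is_derivation (R : fieldType) (n : nat)
    (theta : {linear {mpoly R[n]} -> {mpoly R[n]}}) : Prop :=
  forall f g : {mpoly R[n]}, theta (f * g) = theta f * g + f * theta g.

(* D(A), in the coordinates given by b.  The forms phi such that
   space A :&: ker phi = H are exactly the defining forms alpha_H of H; they
   are proportional to each other, hence give equivalent conditions. *)
Definition log_derivation (R : fieldType) (V : vectType R)
    (A : arrangement V) (n : nat) (b : n.-tuple V)
    (theta : {linear {mpoly R[n]} -> {mpoly R[n]}}) : Prop :=
  is_derivation theta /\
  forall (H : {vspace V}) (phi : 'Hom(V, R^o)),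
    H \in planes A -> (space A :&: lker phi)%VS = H ->
    exists g : {mpoly R[n]}, theta (form_poly b phi) = form_poly b phi * g.

Definition log_basis (R : fieldType) (V : vectType R)
    (A : arrangement V) (n : nat) (b : n.-tuple V) (r : nat)
    (theta : 'I_r -> {linear {mpoly R[n]} -> {mpoly R[n]}}) : Prop :=
  (forall i : 'I_r, log_derivation A b (theta i)) /\
  (forall eta : {linear {mpoly R[n]} -> {mpoly R[n]}},
     log_derivation A b eta ->
     exists! f : {ffun 'I_r -> {mpoly R[n]}},
       forall g : {mpoly R[n]}, eta g = \sum_(i < r) f i * theta i g).

(* A is free and e lists, in some order, its exponents.  A derivation is
   homogeneous of (polynomial) degree e if it maps every coordinate to a
   homogeneous polynomial of degree e.  The choice of the basis b of the
   ambient space amounts to a linear change of coordinates. *)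
Definition free_with_exponents (R : fieldType) (V : vectType R)
    (A : arrangement V) (e : seq nat) : Prop :=
  exists (b : (\dim (space A)).-tuple V)
         (theta : 'I_(size e) -> {linear {mpoly R[\dim (space A)]} ->
                                         {mpoly R[\dim (space A)]}}),
    [/\ basis_of (space A) b,
        log_basis A b theta
      & forall (i : 'I_(size e)) (j : 'I_(\dim (space A))),
          theta i 'X_j \is (nth 0%N e i).-homog].

Definition sub_multiset (e1 e2 : seq nat) : Prop :=
  forall a : nat, (count_mem a e1 <= count_mem a e2)%N.

Inductive inductively_free (R : fieldType) (V : vectType R) :
    arrangement V -> Prop :=
| inductively_free_empty (X : {vspace V}) :
    inductively_free (Arrangement X fset0)
| inductively_free_add (A : arrangement V) (H : {vspace V})
    (e1 e2 : seq nat) :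
    H \in planes A ->
    inductively_free (deletion A H) ->
    inductively_free (restriction A H) ->
    free_with_exponents (restriction A H) e1 ->
    free_with_exponents (deletion A H) e2 ->
    sub_multiset e1 e2 ->
    inductively_free A.

Definition ind_flag_accurate (R : fieldType) (V : vectType R)
    (A : arrangement V) (e : seq nat) : Prop :=
  [/\ sorted leq e,
      free_with_exponents A e,
      inductively_free A
    & exists X : nat -> {vspace V},
        [/\ X (\dim (space A)) = space A,
            forall i : nat, (0 < i < \dim (space A))%N ->
              (X i <= X i.+1)%VS
          & forall i : nat, (0 < i <= \dim (space A))%N ->
              [/\ in_lattice A (X i),
                  \dim (X i) = i,
                  inductively_free (restriction A (X i))
                & free_with_exponents (restriction A (X i)) (take i e)]]].

(* The pair (a, c) stands for the affine hyperplane
   a_1 x_1 + ... + a_l x_l = c of R^l. *)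
Definition affine_arrangement (R : fieldType) (l : nat) : Type :=
  seq ('rV[R]_l * R).

Definition orthogonal_hyperplane (R : fieldType) (n : nat) (u : 'rV[R]_n) :
    {vspace 'rV[R]_n} :=
  lker (linfun (mulmxr u^T : 'rV[R]_n -> 'rV[R]_1)).

(* The additional coordinate z is the last one. *)
Definition cone_hyperplane (R : fieldType) (l : nat) (h : 'rV[R]_l * R) :
    {vspace 'rV[R]_(l + 1)} :=
  orthogonal_hyperplane (row_mx h.1 (- h.2)%:M).

Definition infinity_hyperplane (R : fieldType) (l : nat) :
    {vspace 'rV[R]_(l + 1)} :=
  orthogonal_hyperplane (row_mx 0 1%:M).

Definition cone (R : fieldType) (l : nat) (A : affine_arrangement R l) :
    arrangement ('rV[R]_(l + 1) : vectType R) :=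
  Arrangement fullv
    (infinity_hyperplane R l |` [fset cone_hyperplane h | h in A])%fset.

Lemma mem_orthogonal_hyperplane (R : fieldType) (n : nat) (u v : 'rV[R]_n) :
  (v \in orthogonal_hyperplane u) = (\sum_(i < n) u 0 i * v 0 i == 0).
Proof.
rewrite memv_ker lfunE /= [_ *m _]mx11_scalar mxE.
rewrite (eq_bigr (fun i => u 0 i * v 0 i)); last first.
  by move=> i _; rewrite mxE mulrC.
apply/eqP/eqP => [/matrixP /(_ 0 0)|->]; first by rewrite !mxE.
by apply/matrixP=> i j; rewrite !mxE mul0rn.
Qed.

Lemma dim_orthogonal_hyperplane (R : fieldType) (n : nat) (u : 'rV[R]_n) :
  u != 0 -> (\dim (orthogonal_hyperplane u)).+1 = n.
Proof.
move=> u0; pose f := linfun (mulmxr u^T : 'rV[R]_n -> 'rV[R]_1).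
have := limg_ker_dim f fullv; rewrite capfv dimvf dim_matrix mul1r.
have /eqP -> : \dim (limg f) == 1%N.
  rewrite eqn_leq lt0n dimv_eq0; apply/andP; split.
    by have := dimvS (subvf (limg f)); rewrite dimvf dim_matrix.
  apply: contraNneq u0 => f0; apply/eqP/rowP=> i; rewrite [RHS]mxE.
  have : f (delta_mx 0 i) \in limg f by rewrite memv_img ?memvf.
  rewrite f0 memv0 lfunE /= -rowE => /eqP/matrixP /(_ 0 0).
  by rewrite !mxE.
by rewrite addn1.
Qed.

Lemma mem_cone_hyperplane (R : fieldType) (l : nat) (a x : 'rV[R]_l)
    (c z : R) :
  (row_mx x z%:M \in cone_hyperplane (a, c)) =
  (\sum_(i < l) a 0 i * x 0 i == c * z).
Proof.
rewrite mem_orthogonal_hyperplane big_split_ord big_ord1 /=.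
rewrite !row_mxEr !mxE /= mulr1n mulNr subr_eq0; congr (_ == _).
by apply: eq_bigr => i _; rewrite !row_mxEl.
Qed.

Lemma mem_infinity_hyperplane (R : fieldType) (l : nat) (x : 'rV[R]_l)
    (z : R) :
  (row_mx x z%:M \in infinity_hyperplane R l) = (z == 0).
Proof.
rewrite mem_orthogonal_hyperplane big_split_ord big_ord1 /=.
rewrite !row_mxEr !mxE /= !mulr1n mul1r big1 ?add0r // => i _.
by rewrite row_mxEl mxE mul0r.
Qed.

Lemma cone_central (R : fieldType) (l : nat) (A : affine_arrangement R l) :
  (forall h, h \in A -> h.1 != 0) -> central_arrangement (cone A).
Proof.
have neq0 (b : 'rV[R]_l) (t : R) : (b != 0) || (t != 0) ->
    row_mx b t%:M != 0.
  apply: contraTneq => bt0; rewrite negb_or !negbK.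
  have /rowP b0 : row_mx b t%:M = row_mx 0 0 by rewrite bt0 row_mx0.
  apply/andP; split.
    by apply/eqP/rowP=> i; have := b0 (lshift 1 i); rewrite !row_mxEl.
  have := b0 (rshift l 0); rewrite !row_mxEr !mxE eqxx mulr1n => ->.
  by rewrite eqxx.
move=> A0 H /fset1UP HA; split; first exact: subvf.
rewrite dimvf dim_matrix mul1r.
case: HA => [->|/imfsetP[h /= hA ->]]; apply: dim_orthogonal_hyperplane.
  by apply: neq0; rewrite oner_eq0 orbT.
by apply: neq0; rewrite A0.
Qed.

(* The integers s with a <= s <= b. *)
Definition int_range (a b : int) : seq int :=
  [seq a + n%:Z | n <- iota 0 (if a <= b then `|b - a|%N.+1 else 0)].

Lemma mem_int_range (a b s : int) : (s \in int_range a b) = (a <= s <= b).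
Proof.
apply/mapP/andP => [[n]|[las lsb]].
  case: leP => // lab; rewrite mem_iota /= add0n ltnS => nab ->.
  rewrite lerDl; split=> //; rewrite -lerBrDl.
  by apply: (@le_trans _ _ `|b - a|%N%:Z); rewrite ?lez_nat // abszE ger0_norm ?subr_ge0.
exists `|s - a|%N; last by rewrite abszE ger0_norm ?subr_ge0 // [RHS]addrC subrK.
rewrite (le_trans las lsb) mem_iota /= add0n ltnS -lez_nat !abszE.
by rewrite !ger0_norm ?subr_ge0 // ?lerD2r // (le_trans las lsb).
Qed.

(* The coordinate function x_i of R^l, for 1 <= i <= l (1-based). *)
Definition coord_form (R : fieldType) (l i : nat) : 'rV[R]_l :=
  \row_(j < l) (j.+1 == i)%:R.

(* The arrangement A^{p,k}_l(m,d), with 1-based indices i and j. *)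
Definition arr_A (R : realType) (l p k m d : nat) : affine_arrangement R l :=
  let x := coord_form R l in
  [seq (x i - x j, 0) | i <- index_iota 1 l.+1, j <- index_iota i.+1 l.+1]
  ++ [seq (x i - x j, 1) | i <- index_iota 1 (l + 1 - k).+1,
                           j <- index_iota i.+1 (l + 1 - k).+1]
  ++ [seq (x i, s%:~R) | i <- index_iota 1 p.+1,
        s <- int_range (1 - (minn (l - i + 1) k)%:Z - m%:Z) d%:Z]
  ++ [seq (x i, s%:~R) | i <- index_iota p.+1 l.+1,
        s <- int_range (- (minn (l - i + 1) k)%:Z - m%:Z) d%:Z].

(* Main.v *)
(* Freeness is propagated along the induction by the addition theorem.  For an
   arrangement A' + H, Orlik and Terao's polynomial B, of degree b = |A'| - |A''|
   where A'' is the restriction to H = ker alpha, divides theta(alpha) modulo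
   alpha for every theta in D(A').  If exp(A') is exp(A'') together with b, then
   some basis element theta_0 of degree b has theta_0(alpha) = B modulo alpha up
   to a unit: otherwise too many elements of degree at most b would restrict to
   derivations of D(A'').  Correcting the other basis elements by multiples of
   theta_0 and multiplying theta_0 by alpha gives a basis of D(A' + H).
   Comparing cardinalities with sums of exponents makes b automatic, so that
   nothing has to be counted.

   Put n = l + 1 - k.  The coordinates x_i with i > n are modular, because the
   points of x_i are among those of every x_j with j < i; adding the hyperplanes
   that involve x_i always restricts to the arrangement without x_i.  There
   remain n coordinates of Shi type, x_i - x_j = 0, 1 for i < j, with the points
   -a + [i < P] <= s <= d + [i < Q] on x_i, where Q <= P.  This family is stable
   under restriction to an added point: raising Q restricts to the family with
   d + 1, lowering P to the family with a + 1.  It starts from the Shi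
   arrangement, which is the member with points 0, 1 in the differences with the
   last coordinate; adding the points x_i = 0 to it restricts to members again.

   The flag consists of the subspaces x_j = (d + max(n - j, 0)) z for j > r; the
   restriction to it is again of the form above, with d + max(n - r, 0) instead
   of d. *)
Require Import Defs.
From HB Require Import structures.
From mathcomp Require Import all_boot all_order all_algebra.
From mathcomp Require Import finmap.
From mathcomp Require Import mpoly.
From mathcomp Require Import perm reals.
From mathcomp Require Import zify ring.

Set Implicit Arguments.
Unset Strict Implicit.
Unset Printing Implicit Defensive.

Import Order.TTheory GRing.Theory Num.Theory.

Local Open Scope ring_scope.

(** * Divisibility and derivations of polynomial rings *)

Definition divides (S : idomainType) (p f : S) : Prop := exists g, f = p * g.

Definition is_prime_elt (S : idomainType) (p : S) : Prop :=
  p != 0 /\ forall f g, divides p (f * g) -> divides p f \/ divides p g.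

(** Since [q] divides no power of [p], each factor [q] of the product comes from [u]; these factors
    are split off one at a time. *)
Lemma divides_cancel_prime (S : idomainType) (p q u : S) (k m : nat) :
  is_prime_elt q -> ~ divides q p ->
  divides (q ^+ k) (p ^+ m * u) -> divides (q ^+ k) u.
Proof.
move=> [q0 q_prime] qp; elim: k u => [|k IHk] u.
  by move=> _; exists u; rewrite expr0 mul1r.
case=> g Dg; have [m' Dm'] : divides q (p ^+ m * u).
  by exists (q ^+ k * g); rewrite mulrA -exprS.
have q_pm : forall i, ~ divides q (p ^+ i).
  elim=> [[h Dh]|i IHi qpi].
    by apply: qp; exists (h * p); rewrite mulrA -Dh expr0 mul1r.
  by move: qpi; rewrite exprS => /q_prime [].
have [||[u' Du]] := q_prime (p ^+ m) u; first by exists m'.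
  by move/q_pm.
have : divides (q ^+ k) (p ^+ m * u').
  exists g; apply: (mulfI q0).
  by rewrite mulrCA -Du Dg exprS mulrA.
by case/IHk => h Dh; exists h; rewrite Du Dh exprS mulrA.
Qed.

(** Primality of the factors replaces unique factorization: once the power of [F i] is split off,
    the powers of the other primes still divide the quotient. *)
Lemma prod_divides (S : idomainType) (T : eqType) (r : seq T) (F : T -> S)
    (m : T -> nat) (t : S) :
  uniq r -> {in r, forall i, is_prime_elt (F i)} ->
  {in r &, forall i j, i != j -> ~ divides (F i) (F j)} ->
  {in r, forall i, divides (F i ^+ m i) t} ->
  divides (\prod_(i <- r) F i ^+ m i) t.
Proof.
elim: r t => [|i r IHr] t /=; first by exists t; rewrite big_nil mul1r.
move=> /andP[ir ur] Fp Fij Ft.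
have [u Du] := Ft i (mem_head _ _).
have [g Dg] : divides (\prod_(j <- r) F j ^+ m j) u.
  apply: IHr => //.
  - by move=> j jr; apply: Fp; rewrite inE jr orbT.
  - by move=> j k jr kr; apply: Fij; rewrite inE ?jr ?kr orbT.
  move=> j jr; have jir : j \in i :: r by rewrite inE jr orbT.
  apply: (@divides_cancel_prime _ (F i) _ _ _ (m i) (Fp j jir)).
    apply: Fij => //; first exact: mem_head.
    by apply: contraNneq ir => <-.
  by rewrite -Du; apply: Ft.
by exists g; rewrite big_cons -mulrA -Dg.
Qed.

(** Gaussian elimination without division: the pivot row is subtracted from [a] times each other
    row, with the factor that clears the first column, which leaves one row and one column less. *)
Lemma exists_linear_relation (S : idomainType) (m n : nat) (M : 'I_m -> 'I_n -> S) :
  (n < m)%N ->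
  exists2 u : 'I_m -> S, exists i, u i != 0 & forall j, \sum_i u i * M i j = 0.
Proof.
elim: n m M => [|n IHn] [|m] M // nm.
  by exists (fun=> 1) => [|[]//]; exists ord0; rewrite oner_neq0.
have [/existsP[i0 a0]|] := boolP [exists i, M i ord0 != 0]; last first.
  rewrite negb_exists => /forallP M0.
  have [u u0 uM] := IHn m.+1 (fun i j => M i (lift ord0 j)) (ltnW nm).
  exists u => // j; have [k ->|->] := unliftP ord0 j; first exact: uM.
  by rewrite big1 // => i _; rewrite (eqP (negPn (M0 i))) mulr0.
set a := M i0 ord0 in a0.
have [w [i w0] wN] := IHn m (fun i j => a * M (lift i0 i) (lift ord0 j)
   - M (lift i0 i) ord0 * M i0 (lift ord0 j)) nm.
(* The coefficient of the pivot row is forced by the first column. *)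
exists (fun i => if unlift i0 i is Some k then a * w k
                 else - \sum_k w k * M (lift i0 k) ord0).
  by exists (lift i0 i); rewrite liftK mulf_neq0.
move=> j; rewrite (bigD1_ord i0) //= unlift_none.
under [X in _ + X]eq_bigr do rewrite liftK.
have [k ->|->] := unliftP ord0 j; last first.
  rewrite -/a mulNr mulr_suml addrC; apply/eqP; rewrite subr_eq0; apply/eqP.
  by apply: eq_bigr => k _; rewrite -mulrA mulrC.
have E : \sum_l w l * (a * M (lift i0 l) (lift ord0 k)) =
    \sum_l w l * (M (lift i0 l) ord0 * M i0 (lift ord0 k)).
  apply/eqP; rewrite -subr_eq0 -sumrB -[X in _ == X](wN k).
  by apply/eqP/eq_bigr => l _; rewrite mulrBr.
rewrite mulNr mulr_suml addrC.
apply/eqP; rewrite subr_eq0; apply/eqP; transitivity (\sum_(i < m)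
   w i * (a * M (lift i0 i) (lift ord0 k))).
  by apply: eq_bigr => l _; rewrite mulrCA mulrA.
by rewrite E; apply: eq_bigr => l _; rewrite mulrA.
Qed.

Lemma mpoly_ring_ind (R : comNzRingType) (n : nat) (P : {mpoly R[n]} -> Prop) :
  (forall c, P c%:MP) -> (forall i, P 'X_i) ->
  (forall f g, P f -> P g -> P (f + g)) ->
  (forall f g, P f -> P g -> P (f * g)) -> forall f, P f.
Proof.
move=> PC PX PD PM f; rewrite [f]mpolyE.
apply: (big_ind P) => [||m _]; [by rewrite -mpolyC0| exact: (PD)|].
rewrite -mul_mpolyC; apply: (PM) => //; rewrite mpolyXE_id.
apply: (big_ind P) => [||i _]; [by rewrite -mpolyC1| exact: (PM)|].
by elim: (m i) => [|e IHe]; rewrite ?expr0 -?mpolyC1 // exprS; apply: PM.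
Qed.

Section Derivations.
Variables (R : fieldType) (n : nat).
Local Notation S := {mpoly R[n]}.
Implicit Types (theta eta : {linear S -> S}) (h : 'I_n -> S).

Lemma derivationC theta c : is_derivation theta -> theta c%:MP = 0.
Proof.
move=> Dtheta; rewrite -[c%:MP]mulr1 mul_mpolyC linearZ /=.
suff -> : theta 1 = 0 by rewrite scaler0.
by apply: (addrI (theta 1)); rewrite addr0 -{3}[1]mul1r Dtheta mulr1 mul1r.
Qed.

Lemma derivation_eq theta eta : is_derivation theta -> is_derivation eta ->
  (forall k, theta 'X_k = eta 'X_k) -> forall f, theta f = eta f.
Proof.
move=> Dt De E; elim/mpoly_ring_ind => [c|//|f g Ef Eg|f g Ef Eg].
- by rewrite !derivationC.
- by rewrite !linearD /= Ef Eg.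
- by rewrite Dt De Ef Eg.
Qed.

Definition vector_field h (f : S) : S := \sum_k h k * f^`M(k).

Lemma vector_field_is_linear h : linear (vector_field h).
Proof.
move=> a f g; rewrite /vector_field scaler_sumr -big_split /=.
by apply: eq_bigr => k _; rewrite linearP /= mulrDr scalerAr.
Qed.

HB.instance Definition _ h := GRing.isLinear.Build R S S _ (vector_field h)
  (vector_field_is_linear h).

Lemma vector_field_derivation h : is_derivation (vector_field h).
Proof.
move=> f g /=; rewrite /vector_field mulr_suml mulr_sumr -big_split /=.
apply: eq_bigr => k _; rewrite mderivM mulrDr.
by congr (_ + _); [exact: mulrA | exact: mulrCA].
Qed.

Lemma vector_fieldX h k : vector_field h 'X_k = h k.
Proof.
rewrite /vector_field (bigD1 k) //= big1 => [|i /negPf ik].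
  rewrite mderivX mnmE eqxx addr0 scale1r.
  have -> : (U_(k) - U_(k) = 0 :> 'X_{1..n})%MM by apply/mnmP=> j; rewrite !mnmE subnn.
  by rewrite mpolyX0 mulr1.
by rewrite mderivX mnmE eq_sym ik scale0r mulr0.
Qed.

Lemma derivationE theta : is_derivation theta ->
  theta =1 vector_field (fun k => theta 'X_k).
Proof.
move=> Dt; apply: derivation_eq => // [|k]; first exact: vector_field_derivation.
exact: esym (vector_fieldX _ _).
Qed.

End Derivations.

(** * Linear forms *)

Section LinearForms.
Variables (R : fieldType) (V : vectType R).
Implicit Types (X H : {vspace V}) (phi psi : 'Hom(V, R^o)).

Lemma form_polyD n (b : n.-tuple V) phi psi :
  form_poly b (phi + psi) = form_poly b phi + form_poly b psi.
Proof.
rewrite /form_poly -big_split /=; apply: eq_bigr => i _.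
by rewrite add_lfunE scalerDl.
Qed.

Lemma form_polyZ n (b : n.-tuple V) a phi :
  form_poly b (a *: phi) = a *: form_poly b phi.
Proof.
rewrite /form_poly scaler_sumr; apply: eq_bigr => i _.
by rewrite scale_lfunE scalerA.
Qed.

Lemma form_polyB n (b : n.-tuple V) phi psi :
  form_poly b (phi - psi) = form_poly b phi - form_poly b psi.
Proof. by rewrite -scaleN1r form_polyD form_polyZ scaleN1r. Qed.

Lemma eq_form_poly n (b : n.-tuple V) phi psi :
  {in <<b>>%VS, phi =1 psi} -> form_poly b phi = form_poly b psi.
Proof.
move=> E; apply: eq_bigr => i _; congr (_ *: _).
by apply: E; apply: memv_span; apply: mem_tnth.
Qed.

Lemma mcoeff_form_poly n (b : n.-tuple V) phi i :
  (form_poly b phi)@_U_(i) = phi (tnth b i).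
Proof.
rewrite /form_poly raddf_sum /= (bigD1 i) //= big1 => [|j /negPf ji].
  by rewrite mcoeffZ mcoeffX eqxx mulr1 addr0.
by rewrite mcoeffZ mcoeffXU ji mulr0.
Qed.

Lemma form_poly_eq0 n (b : n.-tuple V) phi :
  (form_poly b phi == 0) = (<<b>> <= lker phi)%VS.
Proof.
apply/eqP/span_subvP => [f0 _ /tnthP[i ->]|b0].
  by rewrite memv_ker -mcoeff_form_poly f0 mcoeff0.
rewrite /form_poly big1 // => i _.
by have := b0 _ (mem_tnth i b); rewrite memv_ker => /eqP ->; rewrite scale0r.
Qed.

Lemma form_poly_homog n (b : n.-tuple V) phi : form_poly b phi \is 1.-homog.
Proof.
apply: rpred_sum => i _; apply: rpredZ.
by rewrite dhomogX; apply/eqP; exact: mdeg1.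
Qed.

Definition coord_lfun n (b : n.-tuple V) i : 'Hom(V, R^o) := linfun (coord b i : V -> R^o).

Lemma coord_lfunE n (b : n.-tuple V) i v : coord_lfun b i v = coord b i v.
Proof. by rewrite lfunE. Qed.

Lemma form_poly_coord n (b : n.-tuple V) i :
  free b -> form_poly b (coord_lfun b i) = 'X_i.
Proof.
move=> fb; rewrite /form_poly (bigD1 i) //= big1 => [|j /negPf ji].
  by rewrite coord_lfunE (tnth_nth 0) coord_free // eqxx scale1r addr0.
by rewrite coord_lfunE (tnth_nth 0) coord_free // ji scale0r.
Qed.

(* The polynomial function f on <<b>>, given in the coordinates along b, is
   rewritten in terms of the vectors of b'; this is the restriction to <<b'>>
   when b' is a basis. *)
Definition change_vars n m (b : n.-tuple V) (b' : m.-tuple V)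
    (f : {mpoly R[n]}) : {mpoly R[m]} :=
  f \mPo [tuple form_poly b' (coord_lfun b i) | i < n].

HB.instance Definition _ n m (b : n.-tuple V) (b' : m.-tuple V) :=
  GRing.RMorphism.copy (change_vars b b')
    (comp_mpoly [tuple form_poly b' (coord_lfun b i) | i < n]).
HB.instance Definition _ n m (b : n.-tuple V) (b' : m.-tuple V) :=
  GRing.Linear.copy (change_vars b b')
    (comp_mpoly [tuple form_poly b' (coord_lfun b i) | i < n]).

Lemma change_varsX n m (b : n.-tuple V) (b' : m.-tuple V) i :
  change_vars b b' 'X_i = form_poly b' (coord_lfun b i).
Proof. by rewrite /change_vars comp_mpolyXU -tnth_nth tnth_mktuple. Qed.

Lemma change_varsC n m (b : n.-tuple V) (b' : m.-tuple V) c :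
  change_vars b b' c%:MP = c%:MP.
Proof. exact: comp_mpolyC. Qed.

(** Each vector of [b'] is expanded along [b], which is why its span has to lie in that of [b]. *)
Lemma change_vars_form n m (b : n.-tuple V) (b' : m.-tuple V) phi :
  (<<b'>> <= <<b>>)%VS -> change_vars b b' (form_poly b phi) = form_poly b' phi.
Proof.
move=> b'b; rewrite {1}/form_poly linear_sum /=.
under eq_bigr do rewrite linearZ /= change_varsX /form_poly scaler_sumr.
rewrite exchange_big; apply: eq_bigr => j _ /=.
under eq_bigr do rewrite scalerA coord_lfunE.
rewrite -scaler_suml; congr (_ *: _).
have bj : tnth b' j \in <<b>>%VS by rewrite (subvP b'b) // memv_span ?mem_tnth.
rewrite [in RHS](coord_span bj) linear_sum /=; apply: eq_bigr => i _.
by rewrite linearZ [LHS]mulrC (tnth_nth 0 b).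
Qed.

Lemma change_vars_homog n m (b : n.-tuple V) (b' : m.-tuple V) f d :
  f \is d.-homog -> change_vars b b' f \is d.-homog.
Proof.
move=> /dhomogP fd; rewrite [f]mpolyE linear_sum /=.
rewrite big_seq; apply: rpred_sum => k /fd kd; rewrite linearZ /=; apply: rpredZ.
have {kd}<- : mdeg k = d := kd; rewrite mdegE mpolyXE_id rmorph_prod /=.
apply: (big_ind2 (fun x y => x \is y.-homog)) => [|x1 d1 x2 d2|i _].
- exact: dhomog1.
- exact: dhomogM.
rewrite rmorphXn /= change_varsX -{2}[k i]mul1n.
exact/dhomogMn/form_poly_homog.
Qed.

Lemma change_vars_comp n m k (b : n.-tuple V) (b' : m.-tuple V) (c : k.-tuple V) f :
  (<<c>> <= <<b'>>)%VS ->
  change_vars b' c (change_vars b b' f) = change_vars b c f.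
Proof.
move=> cb'; elim/mpoly_ring_ind: f => [a|i|f g Ef Eg|f g Ef Eg].
- by rewrite !change_varsC.
- by rewrite !change_varsX change_vars_form.
- by rewrite !rmorphD /= Ef Eg.
- by rewrite !rmorphM /= Ef Eg.
Qed.

(** For [alpha v = 1] this is the projection onto the kernel of [alpha] along [v]. The substitution
    [sigma] given by the projected tuple restricts polynomials to the kernel and extends them
    constantly along [v], so that reduction modulo [alpha] takes place inside one polynomial
    ring. *)
Definition projection (alpha : 'Hom(V, R^o)) (v x : V) : V := x - alpha x *: v.

Lemma projection_is_linear alpha v : linear (projection alpha v).
Proof.
move=> a x y; rewrite /projection linearP /= scalerDl scalerBr scalerA.
by rewrite opprD addrACA.
Qed.

HB.instance Definition _ alpha v := GRing.isLinear.Build R V V _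
  (projection alpha v) (projection_is_linear alpha v).

Lemma projection_form n (b : n.-tuple V) alpha v phi :
  form_poly (map_tuple (projection alpha v) b) phi
    = form_poly b phi - phi v *: form_poly b alpha.
Proof.
rewrite -form_polyZ -form_polyB; apply: eq_bigr => i _; congr (_ *: _).
rewrite tnth_map linearB linearZ /= add_lfunE opp_lfunE scale_lfunE.
by congr (_ - _); rewrite [RHS]mulrC.
Qed.

Section Hyperplane.
Variables (n : nat) (b : n.-tuple V) (alpha : 'Hom(V, R^o)) (v : V).
Hypotheses (fb : free b) (bv : v \in <<b>>%VS) (av : alpha v = 1).
Local Notation pb := (map_tuple (projection alpha v) b).
Local Notation a := (form_poly b alpha).
Local Notation sigma := (change_vars b pb).

Lemma projection_sub : (<<pb>> <= <<b>> :&: lker alpha)%VS.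
Proof.
apply/span_subvP => _ /mapP[x xb ->]; rewrite memv_cap memv_ker.
apply/andP; split; first by rewrite rpredB ?rpredZ // memv_span.
by rewrite /projection linearB linearZ /= av [_ *: _]mulr1 subrr.
Qed.

Lemma specialize_form phi : sigma (form_poly b phi) = form_poly b phi - phi v *: a.
Proof.
rewrite change_vars_form ?projection_form //.
exact: subv_trans projection_sub (capvSl _ _).
Qed.

Lemma specialize_alpha : sigma a = 0.
Proof. by rewrite specialize_form av scale1r subrr. Qed.

(** A variable differs from its image by a constant times [a]; such congruences modulo [a] can be
    added and multiplied. *)
Lemma specialize_congr f : exists g, f = sigma f + a * g.
Proof.
elim/mpoly_ring_ind: f => [c|i|f f' [g Dg] [g' Dg']|f f' [g Dg] [g' Dg']].
- by exists 0; rewrite change_varsC mulr0 addr0.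
- exists (coord_lfun b i v)%:MP; rewrite -(form_poly_coord i fb) specialize_form.
  by rewrite mulrC mul_mpolyC subrK.
- by exists (g + g'); rewrite rmorphD /= mulrDr addrACA -Dg -Dg'.
exists (g * sigma f' + f * g'); rewrite rmorphM /= {1}Dg' mulrDr {1}Dg.
by rewrite mulrDr mulrDl -!addrA !mulrA [a * f]mulrC.
Qed.

Lemma specialize_eq0 f : sigma f = 0 <-> divides a f.
Proof.
split=> [f0|[g ->]]; last by rewrite rmorphM /= specialize_alpha mul0r.
by have [g Dg] := specialize_congr f; exists g; rewrite {1}Dg f0 add0r.
Qed.

Lemma specialize_idem f : sigma (sigma f) = sigma f.
Proof.
have [g {2}->] := specialize_congr f.
by rewrite rmorphD rmorphM /= specialize_alpha mul0r addr0.
Qed.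

End Hyperplane.

Lemma exists_eq1 X phi : ~~ (X <= lker phi)%VS -> exists2 v, v \in X & phi v = 1.
Proof.
move=> /subvPn[v vX]; rewrite memv_ker => v0.
by exists ((phi v)^-1 *: v); [rewrite rpredZ | rewrite linearZ /= [LHS]mulVf].
Qed.

(** By [specialize_eq0] the multiples of the form are the kernel of a ring morphism into a
    domain. *)
Lemma form_poly_prime n (b : n.-tuple V) phi :
  free b -> ~~ (<<b>> <= lker phi)%VS -> is_prime_elt (form_poly b phi).
Proof.
move=> fb phi0; split; first by rewrite form_poly_eq0.
have [v vX v1] := exists_eq1 phi0.
move=> f g /(specialize_eq0 fb vX v1); rewrite rmorphM /= => /eqP.
by rewrite mulf_eq0 => /orP[] /eqP /(specialize_eq0 fb vX v1); [left|right].
Qed.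

(** Modulo [phi] the form [psi] becomes [psi - psi v *: phi], which must vanish on the whole
    span. *)
Lemma divides_form_poly n (b : n.-tuple V) phi psi :
  free b -> ~~ (<<b>> <= lker phi)%VS ->
  divides (form_poly b phi) (form_poly b psi) ->
  (<<b>> :&: lker phi <= lker psi)%VS.
Proof.
move=> fb phi0; have [v vX v1] := exists_eq1 phi0.
move=> /(specialize_eq0 fb vX v1); rewrite specialize_form // -form_polyZ -form_polyB.
move=> /eqP; rewrite form_poly_eq0 => /subvP E; apply/subvP => x.
rewrite memv_cap [x \in lker phi]memv_ker => /andP[/E + /eqP x0].
by rewrite !memv_ker add_lfunE opp_lfunE scale_lfunE x0 scaler0 subr0.
Qed.

End LinearForms.

(** * Logarithmic derivations and the restriction polynomial *)

Section LogDerivations.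
Variables (R : fieldType) (V : vectType R).
Implicit Types (X H K L : {vspace V}) (phi psi : 'Hom(V, R^o))
  (s : seq 'Hom(V, R^o)).

(** The projection of [x] along [v] lies in the kernel of [phi], hence in that of [psi]. *)
Lemma lker_cap_proportional X phi psi v :
  v \in X -> phi v = 1 -> (X :&: lker phi <= lker psi)%VS ->
  {in X, psi =1 psi v *: phi}.
Proof.
move=> vX v1 /subvP E x xX; rewrite scale_lfunE.
have : projection phi v x \in lker psi.
  apply: E; rewrite memv_cap memv_ker rpredB ?rpredZ //=.
  by rewrite /projection linearB linearZ /= v1 [_ *: _]mulr1 subrr.
rewrite memv_ker /projection linearB linearZ /= subr_eq0 => /eqP ->.
by rewrite [LHS]mulrC.
Qed.

Lemma eq_lker_cap X phi psi :
  ~~ (X <= lker phi)%VS -> ~~ (X <= lker psi)%VS ->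
  (X :&: lker phi <= lker psi)%VS -> (X :&: lker phi = X :&: lker psi)%VS.
Proof.
move=> /exists_eq1[v vX v1] psi0 /(lker_cap_proportional vX v1) E.
apply/vspaceP => x; rewrite !memv_cap !memv_ker.
case xX: (x \in X) => //=; rewrite E // scale_lfunE.
rewrite [_ *: _ == 0]mulf_eq0 [psi v == 0](_ : _ = false) //.
apply: contraNF psi0 => /eqP pv0; apply/subvP => y yX.
by rewrite memv_ker E // pv0 scale0r lfunE.
Qed.

(** The forms live on the whole of [V], so that one list serves for an arrangement and for its
    restrictions. Proportional forms may occur and give the same hyperplane. *)
Definition arr X s : arrangement V :=
  Arrangement X [fset (X :&: lker phi)%VS | phi in s]%fset.

Lemma mem_arr X s K :
  reflect (exists2 phi, phi \in s & K = (X :&: lker phi)%VS) (K \in planes (arr X s)).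
Proof. exact: imfsetP. Qed.

Definition logder s n (b : n.-tuple V) (theta : {linear {mpoly R[n]} -> {mpoly R[n]}}) :=
  is_derivation theta /\
  {in s, forall phi, divides (form_poly b phi) (theta (form_poly b phi))}.

(** Another defining form of a listed hyperplane is, on [X], a scalar multiple of the listed form,
    so it suffices to test the list. *)
Lemma log_derivationP X s n (b : n.-tuple V) theta :
  <<b>>%VS = X -> {in s, forall phi, ~~ (X <= lker phi)%VS} ->
  log_derivation (arr X s) b theta <-> logder s b theta.
Proof.
move=> bX s0; split=> [[Dt tP]|[Dt tP]]; split=> //.
  by move=> phi ps; apply: (tP (X :&: lker phi)%VS) => //; apply/mem_arr; exists phi.
move=> _ psi /mem_arr[phi ps ->] E.
have [v vX v1] := exists_eq1 (s0 _ ps).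
have : (X :&: lker phi <= lker psi)%VS by rewrite -E capvSr.
move/(lker_cap_proportional vX v1); rewrite -bX => /eq_form_poly ->.
have [g Dg] := tP _ ps.
by exists g; rewrite form_polyZ linearZ /= Dg scalerAl.
Qed.

(** Choosing one form per hyperplane avoids counting proportional forms twice; the default 0 is
    never reached for a hyperplane of the arrangement. *)
Definition plane_form s X K := nth 0 s (find (fun phi => X :&: lker phi == K)%VS s).

Lemma plane_formP s X K : K \in planes (arr X s) ->
  plane_form s X K \in s /\ (X :&: lker (plane_form s X K) = K)%VS.
Proof.
move=> /mem_arr[phi ps DK].
have hasK : has (fun phi => X :&: lker phi == K)%VS s by apply/hasP; exists phi; rewrite // DK.
by split; [rewrite mem_nth -?has_find | apply/eqP; exact: (nth_find 0 hasK)].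
Qed.

Section RestrictionPolynomial.
Variables (X : {vspace V}) (n : nat) (b : n.-tuple V) (s : seq 'Hom(V, R^o)).
Variables (alpha : 'Hom(V, R^o)) (v : V).
Hypotheses (fb : free b) (bX : <<b>>%VS = X) (vX : v \in X) (av : alpha v = 1).
Local Notation H := (X :&: lker alpha)%VS.
Hypothesis sH : {in s, forall phi, ~~ (H <= lker phi)%VS}.
Local Notation pb := (map_tuple (projection alpha v) b).
Local Notation a := (form_poly b alpha).
Local Notation sigma := (change_vars b pb).

Let r : seq {vspace V} := enum_fset (planes (arr X s)).
Let trace K := (H :&: K)%VS.
Let mult L := count_mem L (map trace r).
(** Subtracting a multiple of [alpha] makes the form vanish at [v], hence invariant under [sigma],
    without changing it on [H]. *)
Let psi L := plane_form s H L - plane_form s H L v *: alpha.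

Definition restriction_poly : {mpoly R[n]} :=
  \prod_(L <- undup (map trace r)) form_poly b (psi L) ^+ (mult L).-1.

Lemma nonzero_on_space phi : phi \in s -> ~~ (X <= lker phi)%VS.
Proof. by move=> /sH; apply: contraNN; apply: subv_trans; apply: capvSl. Qed.

Lemma trace_cap phi : trace (X :&: lker phi) = (H :&: lker phi)%VS.
Proof.
by apply/vspaceP => x; rewrite !memv_cap; case: (x \in X); rewrite //= andbF.
Qed.

Lemma trace_planes : undup (map trace r) =i planes (arr H s).
Proof.
move=> L; rewrite mem_undup; apply/mapP/mem_arr => [[K]|[phi ps ->]].
  move=> /mem_arr[phi ps ->] ->; exists phi => //.
  exact: trace_cap.
exists (X :&: lker phi)%VS; first by apply/mem_arr; exists phi.
exact: esym (trace_cap _).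
Qed.

Lemma psiP L : L \in planes (arr H s) ->
  [/\ psi L v = 0, (H :&: lker (psi L) = L)%VS,
      ~~ (H <= lker (psi L))%VS & {in H, psi L =1 plane_form s H L}].
Proof.
move=> /plane_formP[fs DL].
have E : {in H, psi L =1 plane_form s H L}.
  move=> x; rewrite memv_cap memv_ker => /andP[_ /eqP x0].
  by rewrite add_lfunE opp_lfunE scale_lfunE x0 scaler0 subr0.
have HL : (H :&: lker (psi L) = L)%VS.
  rewrite -[RHS]DL; apply/vspaceP => x; rewrite !(memv_cap x H) !memv_ker.
  by case xH: (x \in H) => //=; rewrite E.
split=> //.
  by rewrite add_lfunE opp_lfunE scale_lfunE av [_ *: 1]mulr1 subrr.
apply: contraNN (sH fs) => Hpsi; apply/subvP => x xH.
by rewrite memv_ker -E // -memv_ker (subvP Hpsi).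
Qed.

Lemma multP L : L \in planes (arr H s) -> (0 < mult L)%N.
Proof. by rewrite -trace_planes mem_undup -has_pred1 has_count. Qed.

(** The multiplicities add up to the number of hyperplanes, and one is subtracted for each
    hyperplane of the restriction. *)
Lemma restriction_poly_homog :
  restriction_poly \is (#|` planes (arr X s)| - #|` planes (arr H s)|).-homog.
Proof.
have -> : (#|` planes (arr X s)| - #|` planes (arr H s)|)%N
    = (\sum_(L <- undup (map trace r)) (mult L).-1)%N.
  have -> : #|` planes (arr X s)| = (\sum_(L <- undup (map trace r)) mult L)%N.
    rewrite -[LHS](size_map trace) -sum1_size -big_undup_iterop_count /=.
    by apply: eq_bigr => L _; rewrite Monoid.iteropE iter_addn_0 mul1n.
  have -> : #|` planes (arr H s)| = (\sum_(L <- undup (map trace r)) 1)%N.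
    rewrite sum1_size; apply/perm_size/uniq_perm.
    - exact: fset_uniq.
    - exact: undup_uniq.
    by move=> L; rewrite trace_planes.
  rewrite big_seq [X in (_ - X)%N]big_seq [RHS]big_seq -sumnB => [|L].
    by apply: eq_bigr => L _; rewrite subn1.
  by rewrite trace_planes => /multP.
apply: (big_ind2 (fun x y => x \is y.-homog)) => [|x1 d1 x2 d2|L _].
- exact: dhomog1.
- exact: dhomogM.
by have := dhomogMn (mult L).-1 (form_poly_homog b (psi L)); rewrite mul1n.
Qed.

Lemma psi_prime L : L \in planes (arr H s) -> is_prime_elt (form_poly b (psi L)).
Proof.
move=> /psiP[_ _ psi0 _]; apply: form_poly_prime => //; rewrite bX.
by apply: contraNN psi0; apply: subv_trans; apply: capvSl.
Qed.

Lemma specialize_psi L : L \in planes (arr H s) ->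
  sigma (form_poly b (psi L)) = form_poly b (psi L).
Proof.
by move=> /psiP[pv _ _ _]; rewrite specialize_form ?bX // pv scale0r subr0.
Qed.

(** The form of [K] and [psi L] have the same kernel in [H], so they are proportional there; a
    multiple of [alpha] then matches the values at [v]. *)
Lemma trace_decomposition K L :
  K \in planes (arr X s) -> L \in planes (arr H s) -> trace K = L ->
  exists2 u, u != 0 &
    form_poly b (plane_form s X K) =
      u *: form_poly b (psi L) + plane_form s X K v *: a.
Proof.
move=> /plane_formP[fs DK] LH DL; set phi := plane_form s X K in fs DK *.
have [pv HL psi0 _] := psiP LH.
have [w wH w1] := exists_eq1 psi0.
have Hphi : (H :&: lker phi = L)%VS.
  rewrite -DL /trace -DK; apply/vspaceP => x; rewrite !memv_cap.
  by case: (x \in X).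
have E : {in H, phi =1 phi w *: psi L}.
  by apply: lker_cap_proportional => //; rewrite HL -Hphi capvSr.
exists (phi w).
  apply: contraNneq (sH fs) => pw0; apply/subvP => x xH.
  by rewrite memv_ker E // pw0 scale0r lfunE.
rewrite -!form_polyZ -form_polyD; apply: eq_form_poly => x; rewrite bX => xX.
have pxH : projection alpha v x \in H.
  rewrite memv_cap memv_ker rpredB ?rpredZ //=.
  by rewrite /projection linearB linearZ /= av [_ *: _]mulr1 subrr.
have := E _ pxH; rewrite /projection add_lfunE !scale_lfunE.
rewrite !linearB !linearZ /= pv oppr0 !scaler0 addr0 scalerN => /eqP.
rewrite subr_eq => /eqP ->; congr (_ + _); exact: mulrC.
Qed.

(** Every form with trace [L] is a combination of [F] and [a], so it divides [Z]; these forms are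
    non-associated primes, so their product divides [Z] too. Under [sigma] the product becomes a
    constant times [F ^+ mult L], while [Z] becomes [F] times the value in question, and one factor
    [F] cancels. *)
Lemma psi_power_divides L theta : L \in planes (arr H s) -> logder s b theta ->
  divides (form_poly b (psi L) ^+ (mult L).-1) (sigma (theta a)).
Proof.
move=> LH [Dt tP]; set F := form_poly b (psi L).
pose Z := F * theta a - a * theta F.
pose rL := [seq K <- r | trace K == L].
have rLP K : K \in rL -> K \in planes (arr X s) /\ trace K = L.
  by rewrite mem_filter => /andP[/eqP].
have [g Dg] : divides (\prod_(K <- rL) form_poly b (plane_form s X K) ^+ 1) Z.
  apply: (@prod_divides _ _ rL (fun K => form_poly b (plane_form s X K)) (fun=> 1%N)).
  - exact/filter_uniq/fset_uniq.
  - move=> K /rLP[/plane_formP[fs _] _]; apply: form_poly_prime => //.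
    by rewrite bX nonzero_on_space.
  - move=> K K' /rLP[/plane_formP[fs DK] _] /rLP[/plane_formP[fs' DK'] _] KK'.
    move=> /(divides_form_poly fb); rewrite bX => /(_ (nonzero_on_space fs)) E.
    case/eqP: KK'; rewrite -DK -DK'.
    by apply: eq_lker_cap; rewrite ?nonzero_on_space.
  move=> K /rLP[KX KL]; have [u u0 Dphi] := trace_decomposition KX LH KL.
  have [fs _] := plane_formP KX; have [g Dg] := tP _ fs.
  set f := form_poly b (plane_form s X K) in Dphi Dg *.
  set c := plane_form s X K v in Dphi.
  have DF : F = u^-1 *: (f - c *: a) by rewrite Dphi addrK scalerA mulVf ?scale1r.
  have DtF : theta F = u^-1 *: (f * g - c *: theta a).
    by rewrite DF linearZ /= linearB /= linearZ /= Dg.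
  (* As [F] is proportional to [f - c *: a], the two terms in [a * theta a] cancel in [Z]. *)
  exists (u^-1 *: (theta a - a * g)); rewrite expr1 /Z DtF DF.
  rewrite -!scalerAr -scalerAl -scalerBr; congr (_ *: _).
  by rewrite -!mul_mpolyC; ring.
have mL : mult L = size rL by rewrite /mult count_map size_filter.
have [c c0 Dc] : exists2 c, c != 0 &
    \prod_(K <- rL) sigma (form_poly b (plane_form s X K)) = c *: F ^+ size rL.
  elim: (rL) rLP => [|K q IHq] qP.
    by exists 1; rewrite ?oner_neq0 // big_nil scale1r expr0.
  have [|c c0 Dc] := IHq; first by move=> K' K'q; apply: qP; rewrite inE K'q orbT.
  have [KX KL] := qP K (mem_head _ _).
  have [u u0 Dphi] := trace_decomposition KX LH KL.
  exists (u * c); first exact: mulf_neq0.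
  rewrite big_cons Dc specialize_form ?bX // Dphi addrK exprS.
  by rewrite -scalerAl -scalerAr scalerA.
exists (c *: sigma g).
have F0 : F != 0 by case: (psi_prime LH).
apply: (mulfI F0); have := congr1 sigma Dg.
rewrite /Z rmorphB !rmorphM /= specialize_psi // specialize_alpha ?bX // mul0r subr0 => ->.
rewrite rmorph_prod; under eq_bigr do rewrite rmorphXn expr1.
by rewrite Dc -scalerAl scalerAr mulrA -exprS prednK ?multP // mL.
Qed.

(* Orlik and Terao's polynomial B: on restriction to H the values theta(alpha),
   for theta logarithmic along the other hyperplanes, are all multiples of it. *)
Lemma restriction_poly_divides theta : logder s b theta ->
  divides restriction_poly (sigma (theta a)).
Proof.
move=> Dt; apply: prod_divides; first exact: undup_uniq.
- by move=> L; rewrite trace_planes => /psi_prime.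
- move=> L L'; rewrite !trace_planes => LH LH' LL' /(divides_form_poly fb).
  have [_ DL psi0 _] := psiP LH; have [_ DL' psi0' _] := psiP LH'.
  rewrite bX => E; case/eqP: LL'; rewrite -DL -DL'; apply: eq_lker_cap => //.
  apply: subv_trans (E _); first by rewrite capvS ?capvSl.
  by apply: contraNN psi0; apply: subv_trans; apply: capvSl.
by move=> L; rewrite trace_planes => LH; apply: psi_power_divides.
Qed.

End RestrictionPolynomial.
End LogDerivations.

(** * The addition theorem *)

Lemma exists_linear_relation_in (S : idomainType) (I J : finType)
    (A : {pred I}) (B : {pred J}) (M : I -> J -> S) :
  (#|B| < #|A|)%N ->
  exists u : I -> S, [/\ exists i, u i != 0, forall i, i \notin A -> u i = 0
    & forall j, j \in B -> \sum_i u i * M i j = 0].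
Proof.
move=> /(exists_linear_relation (fun i j => M (enum_val i) (enum_val j))).
case=> w [i0 w0] wM.
pose u i := \sum_(k < #|A|) if enum_val k == i then w k else 0.
have uA k : u (enum_val k) = w k.
  rewrite /u (bigD1 k) //= eqxx big1 ?addr0 // => l /negPf lk.
  by rewrite (inj_eq enum_val_inj) lk.
have u0 i : i \notin A -> u i = 0.
  move=> iA; rewrite /u big1 // => k _; case: eqP => // ki.
  by rewrite -ki enum_valP in iA.
exists u; split=> //; first by exists (enum_val i0); rewrite uA.
move=> j jB; have [l ->] : exists l : 'I_#|B|, j = enum_val l.
  by exists (enum_rank_in jB j); rewrite enum_rankK_in.
rewrite (bigID (mem A)) /= [X in _ + X]big1 ?addr0 => [|i /u0->]; last exact: mul0r.
by rewrite big_enum_val -[RHS](wM l); apply: eq_bigr => k _; rewrite uA.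
Qed.

(** This lets the coefficient of a homogeneous factor be replaced by its component of the right
    degree, which is zero when the factor has degree above [d]. *)
Lemma pihomogM (R : comNzRingType) (n d e : nat) (p q : {mpoly R[n]}) :
  q \is e.-homog ->
  pihomog mdeg d (p * q) = (if (e <= d)%N then pihomog mdeg (d - e) p else 0) * q.
Proof.
move=> qe; rewrite [p]mpolyE mulr_suml !linear_sum /=.
rewrite (_ : (if _ then _ else _) =
  \sum_(m <- msupp p) if (mdeg m + e == d)%N then p@_m *: 'X_[m] else 0).
  rewrite mulr_suml; apply: eq_bigr => m _; rewrite -scalerAl linearZ /=.
  have h : 'X_[m] * q \is (mdeg m + e).-homog by rewrite dhomogM ?dhomogX.
  case: eqP => [<-|/eqP ne]; first by rewrite pihomog_dE // scalerAl.
  by rewrite (pihomog_ne0 _ h) // scaler0 mul0r.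
case: leqP => ed.
  apply: eq_bigr => m _; rewrite linearZ /= pihomogX.
  by rewrite -(eqn_add2r e) subnK //; case: eqP => // _; rewrite scaler0.
rewrite big1 // => m _; case: eqP => // Dd.
by move: ed; rewrite -Dd ltnNge leq_addl.
Qed.

Lemma dhomog0_const (R : comNzRingType) (n : nat) (p : {mpoly R[n]}) :
  p \is 0.-homog -> p = (p@_0)%:MP.
Proof.
move=> p0; apply/mpolyP => m; rewrite mcoeffC.
have [<-|m0] := eqVneq 0%MM m; first by rewrite mulr1.
by rewrite mulr0 (dhomog_nemf_coeff p0) // mdeg_eq0 eq_sym.
Qed.

Lemma vector_field_sum (R : fieldType) (n : nat) (I : finType) (f : I -> {mpoly R[n]})
    (theta : I -> {linear {mpoly R[n]} -> {mpoly R[n]}}) g :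
  (forall i, is_derivation (theta i)) ->
  vector_field (fun k => \sum_i f i * theta i 'X_k) g = \sum_i f i * theta i g.
Proof.
move=> Dt; rewrite /vector_field; under eq_bigr do rewrite mulr_suml.
rewrite exchange_big; apply: eq_bigr => i _ /=.
rewrite (derivationE (Dt i)) /vector_field mulr_sumr.
by apply: eq_bigr => k _; rewrite mulrA.
Qed.

Section Addition.
Variables (R : fieldType) (V : vectType R).
Implicit Types (s : seq 'Hom(V, R^o)).

(** Compared with [log_basis], existence and uniqueness of coefficients become generation and
    independence, both tested on the variables. The degrees are a function of the index, so that a
    single basis element can be modified. *)
Definition free_family s n (b : n.-tuple V) r (deg : 'I_r -> nat)
    (theta : 'I_r -> {linear {mpoly R[n]} -> {mpoly R[n]}}) : Prop :=
  [/\ forall i, logder s b (theta i),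
      forall eta, logder s b eta ->
        exists f : 'I_r -> {mpoly R[n]},
          forall k, eta 'X_k = \sum_i f i * theta i 'X_k,
      forall f : 'I_r -> {mpoly R[n]},
        (forall k, \sum_i f i * theta i 'X_k = 0) -> forall i, f i = 0
    & forall i k, theta i 'X_k \is (deg i).-homog].

Lemma derivation_form_homog n (b : n.-tuple V)
    (theta : {linear {mpoly R[n]} -> {mpoly R[n]}}) d phi :
  (forall k, theta 'X_k \is d.-homog) -> theta (form_poly b phi) \is d.-homog.
Proof.
move=> td; rewrite linear_sum; apply: rpred_sum => i _.
by rewrite linearZ; apply: rpredZ.
Qed.

Variables (n : nat) (b : n.-tuple V) (s : seq 'Hom(V, R^o)).
Variables (alpha : 'Hom(V, R^o)) (v : V).
Hypotheses (fb : free b) (vX : v \in <<b>>%VS) (av : alpha v = 1).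
Local Notation X := <<b>>%VS.
Local Notation H := (X :&: lker alpha)%VS.
Hypothesis sH : {in s, forall phi, ~~ (H <= lker phi)%VS}.
Local Notation pb := (map_tuple (projection alpha v) b).
Local Notation a := (form_poly b alpha).
Local Notation sigma := (change_vars b pb).
Variables (r : nat) (deg : 'I_r -> nat)
  (theta : 'I_r -> {linear {mpoly R[n]} -> {mpoly R[n]}}).
Hypothesis theta_basis : free_family s b deg theta.

Section Restriction.
Variables (n' : nat) (b' : n'.-tuple V) (r' : nat) (deg' : 'I_r' -> nat)
  (theta' : 'I_r' -> {linear {mpoly R[n']} -> {mpoly R[n']}}).
Hypotheses (fb' : free b') (bH : <<b'>>%VS = H).
Hypothesis theta'_basis : free_family s b' deg' theta'.
Local Notation rho := (change_vars b b').
Local Notation tau := (change_vars b' pb).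

Let b'b : (<<b'>> <= <<b>>)%VS. Proof. by rewrite bH capvSl. Qed.
Let pbb' : (<<pb>> <= <<b'>>)%VS. Proof. by rewrite bH projection_sub. Qed.

(** [tau] extends a polynomial on [H] constantly along [v], and [rho] restricts it back to [H]. *)
Lemma restriction_section f : rho (tau f) = f.
Proof.
elim/mpoly_ring_ind: f => [c|i|f g Ef Eg|f g Ef Eg].
- by rewrite !change_varsC.
- rewrite change_varsX projection_form -form_polyZ -form_polyB change_vars_form //.
  rewrite -[RHS](form_poly_coord i fb'); apply: eq_form_poly => x.
  rewrite bH memv_cap memv_ker => /andP[_ /eqP x0].
  by rewrite add_lfunE opp_lfunE scale_lfunE x0 scaler0 subr0.
- by rewrite !rmorphD /= Ef Eg.
- by rewrite !rmorphM /= Ef Eg.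
Qed.

Lemma restriction_alpha : rho a = 0.
Proof.
apply/eqP; rewrite change_vars_form // form_poly_eq0 bH; exact: capvSr.
Qed.

Lemma section_restriction f : tau (rho f) = sigma f.
Proof. exact: change_vars_comp. Qed.

Definition restrict_derivation (eta : {linear {mpoly R[n]} -> {mpoly R[n]}}) :
    {linear {mpoly R[n']} -> {mpoly R[n']}} :=
  vector_field (fun k => rho (eta (tau 'X_k))).

Lemma restrict_derivationE eta f : is_derivation eta ->
  restrict_derivation eta f = rho (eta (tau f)).
Proof.
move=> De; have Dr := vector_field_derivation (fun k => rho (eta (tau 'X_k))).
elim/mpoly_ring_ind: f => [c|i|f g Ef Eg|f g Ef Eg].
- by rewrite change_varsC !derivationC // rmorph0.
- exact: vector_fieldX.
- by rewrite linearD Ef Eg !rmorphD linearD rmorphD.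
- by rewrite [LHS]Dr Ef Eg rmorphM De rmorphD !rmorphM /= !restriction_section.
Qed.

(** If [eta a] lies in the ideal of [a], then [eta] acts on polynomials modulo [a], that is, on
    those of [H]. The lift of [phi] is [phi] minus a multiple of [alpha], and the resulting extra
    term vanishes under [rho]. *)
Lemma restrict_logder eta : logder s b eta -> sigma (eta a) = 0 ->
  logder s b' (restrict_derivation eta).
Proof.
move=> [De eP] ea0; split; first exact: vector_field_derivation.
move=> phi ps; rewrite restrict_derivationE // change_vars_form //.
have [g Dg] := eP _ ps; exists (rho g).
have -> : eta (form_poly pb phi) = form_poly b phi * g - phi v *: eta a.
  by rewrite projection_form -Dg linearB; congr (_ - _); rewrite linearZ.
rewrite rmorphB rmorphM /= linearZ /=.
rewrite change_vars_form //; have [g' ->] := (specialize_eq0 fb vX av _).1 ea0.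
by rewrite rmorphM /= restriction_alpha mul0r scaler0 subr0.
Qed.

(* Otherwise the restrictions to H of too many basis elements would lie in the
   span of too few. *)
Lemma exists_nonvanishing d :
  (#|[pred j | deg' j <= d]| < #|[pred i | deg i <= d]|)%N ->
  exists2 i, (deg i <= d)%N & sigma (theta i a) != 0.
Proof.
move=> card_lt.
have [i /andP[]|vanish] := pickP (fun i => (deg i <= d)%N && (sigma (theta i a) != 0)).
  by exists i.
exfalso.
have [Dt gen_t ind_t hom_t] := theta_basis.
have [_ gen_t' _ hom_t'] := theta'_basis.
have ta0 i : (deg i <= d)%N -> sigma (theta i a) = 0.
  by move=> id; have := vanish i; rewrite id => /negbFE /eqP.
(* The coefficients are replaced by their components of degree [deg i - deg' j], so basis elements
   of degree above [d] do not occur. *)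
have /fin_all_exists [M MP] i : exists g : 'I_r' -> {mpoly R[n']}, (deg i <= d)%N ->
    (forall k, restrict_derivation (theta i) 'X_k = \sum_j g j * theta' j 'X_k)
    /\ (forall j, (d < deg' j)%N -> g j = 0).
  case: (leqP (deg i) d) => [id|_]; last by exists (fun=> 0).
  have [f Df] := gen_t' _ (restrict_logder (Dt i) (ta0 i id)).
  exists (fun j => if (deg' j <= deg i)%N then pihomog mdeg (deg i - deg' j) (f j) else 0).
  move=> _; split=> [k|j jd]; last by rewrite leqNgt (leq_ltn_trans id jd).
  have -> : restrict_derivation (theta i) 'X_k
      = pihomog mdeg (deg i) (restrict_derivation (theta i) 'X_k).
    rewrite pihomog_dE // restrict_derivationE; last by case: (Dt i).
    rewrite change_varsX change_vars_homog //; exact: derivation_form_homog.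
  by rewrite Df linear_sum; apply: eq_bigr => j _; rewrite /= (pihomogM _ _ (hom_t' j k)).
(* The rows with [deg i <= d] outnumber the columns with [deg' j <= d], which gives a nontrivial
   relation between the restrictions. *)
have [u [[i1 u1] uA uM]] := exists_linear_relation_in M card_lt.
have uMj j : \sum_i u i * M i j = 0.
  have [jd|jd] := leqP (deg' j) d; first exact: uM.
  rewrite big1 // => i _; have [/MP[_ ->]//|id] := leqP (deg i) d; first exact: mulr0.
  by rewrite uA ?mul0r // inE -ltnNge.
have uX f : \sum_i u i * restrict_derivation (theta i) f = 0.
  rewrite /= -vector_field_sum => [|i]; last exact: vector_field_derivation.
  rewrite /vector_field big1 // => k _.
  rewrite (_ : \sum_i _ = 0) ?mul0r //.
  transitivity (\sum_i \sum_j u i * M i j * theta' j 'X_k).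
    apply: eq_bigr => i _; have [/MP[E _]|id] := leqP (deg i) d; last first.
      rewrite uA ?inE -?ltnNge // mul0r big1 // => j _; by rewrite !mul0r.
    by rewrite [restrict_derivation _ _]E mulr_sumr; apply: eq_bigr => j _; rewrite mulrA.
  rewrite exchange_big big1 // => j _ /=.
  by rewrite -mulr_suml uMj mul0r.
have Dder i : is_derivation (theta i) by case: (Dt i).
(* Lifted by [tau], the relation holds modulo [a], so the combination of the [theta i] is [a] times
   a vector field. *)
have /fin_all_exists[h Dh] k : divides a (\sum_i tau (u i) * theta i 'X_k).
  apply/(specialize_eq0 fb vX av); rewrite -section_restriction.
  rewrite (_ : rho _ = 0) ?rmorph0 //.
  rewrite rmorph_sum -[RHS](uX (rho 'X_k)); apply: eq_bigr => i _.
  rewrite rmorphM /= restriction_section restrict_derivationE // section_restriction.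
  have [id|id] := leqP (deg i) d; last by rewrite uA ?mul0r // inE -ltnNge.
  have [g {1}->] := specialize_congr fb vX av 'X_k.
  have [g' Dg'] := (specialize_eq0 fb vX av _).1 (ta0 i id).
  rewrite linearD /= Dder Dg' rmorphD [X in _ + X]rmorphD !rmorphM /=.
  by rewrite restriction_alpha !mul0r !addr0.
have aE f : a * vector_field h f = \sum_i tau (u i) * theta i f.
  rewrite -vector_field_sum // mulr_sumr; apply: eq_bigr => k _.
  by rewrite Dh mulrA.
(* The quotient is again logarithmic: the prime form of [phi] divides its product with [a] but does
   not divide [a]. *)
have [] := gen_t (vector_field h).
  split; first exact: vector_field_derivation.
  move=> phi ps; have phi0 : ~~ (X <= lker phi)%VS.
    by apply: contraNN (sH ps); apply: subv_trans; apply: capvSl.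
  have [_ phi_prime] := form_poly_prime fb phi0.
  have [|/(divides_form_poly fb phi0) E|//] := phi_prime a (vector_field h (form_poly b phi)).
    rewrite aE; have /fin_all_exists[g Dg] i : divides (form_poly b phi) (theta i (form_poly b phi)).
      by case: (Dt i) => _; apply.
    exists (\sum_i tau (u i) * g i); rewrite mulr_sumr; apply: eq_bigr => i _.
    by rewrite Dg mulrCA.
  have a0 : ~~ (X <= lker alpha)%VS.
    by apply/subvPn; exists v => //; rewrite memv_ker av oner_eq0.
  by case/negP: (sH ps); rewrite -(eq_lker_cap phi0 a0 E) capvSr.
(* Independence gives [tau (u i) = a * w i], which vanishes on [H]; hence every [u i] is zero, a
   contradiction. *)
move=> w Dw; have wu i : tau (u i) - a * w i = 0.
  move: i; apply: ind_t => k; under eq_bigr do rewrite mulrBl -mulrA.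
  rewrite sumrB -mulr_sumr -Dw /= vector_fieldX -Dh; exact: subrr.
case/eqP: u1; rewrite -[LHS]restriction_section.
by rewrite (subr0_eq (wu i1)) rmorphM /= restriction_alpha mul0r.
Qed.

End Restriction.

(** Subtracting [q i] times [theta i0] from every other [theta i] makes its value at [a] divisible
    by [a]; [theta i0] itself is multiplied by [a]. The conditions on degrees keep the family
    homogeneous. *)
Lemma free_family_add i0 (q : 'I_r -> {mpoly R[n]}) :
  sigma (theta i0 a) != 0 ->
  (forall i, sigma (theta i a) = q i * sigma (theta i0 a)) ->
  (forall i, q i != 0 -> (deg i0 <= deg i)%N) ->
  (forall i, q i \is (deg i - deg i0).-homog) ->
  exists theta1, free_family (alpha :: s) b
    (fun i => if i == i0 then (deg i0).+1 else deg i) theta1.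
Proof.
move=> nz qP qdeg qhom; have [Dt gen_t ind_t hom_t] := theta_basis.
have q0 : q i0 = 1 by apply: (mulIf nz); rewrite -qP mul1r.
(* A quotient of two values of the idempotent morphism [sigma] is itself fixed by [sigma]. *)
have sq i : sigma (q i) = q i.
  apply: (mulIf nz); rewrite -qP -[RHS]specialize_idem // (qP i) rmorphM /=.
  by rewrite specialize_idem.
have Dder i : is_derivation (theta i) by case: (Dt i).
have a_prime : is_prime_elt a.
  apply: form_poly_prime => //.
  by apply/subvPn; exists v => //; rewrite memv_ker av oner_eq0.
(* [p] and [w] combine the two cases: [a * theta i0] at [i0], and [theta i - q i * theta i0]
   elsewhere. *)
pose p i := if i == i0 then a else 1.
pose w i := if i == i0 then 0 else - q i.
pose theta1 i : {linear _ -> _} :=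
  vector_field (fun k => p i * theta i 'X_k + w i * theta i0 'X_k).
have t1E i f : theta1 i f = p i * theta i f + w i * theta i0 f.
  rewrite /= /vector_field [in RHS](derivationE (Dder i)) (derivationE (Dder i0)).
  rewrite /vector_field !mulr_sumr -big_split; apply: eq_bigr => k _ /=.
  by rewrite mulrDl !mulrA.
have sumE (f : 'I_r -> {mpoly R[n]}) g :
    \sum_i f i * theta1 i g = \sum_i (if i == i0 then a * f i0 - \sum_(j | j != i0) f j * q j
                                     else f i) * theta i g.
  rewrite (bigD1 i0) //= [RHS](bigD1 i0) //= eqxx t1E /p /w eqxx mul0r addr0.
  rewrite mulrBl -!addrA mulrA [f i0 * a]mulrC; congr (_ + _).
  rewrite mulr_suml -sumrN -big_split /=; apply: eq_bigr => i /negPf ii0.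
  by rewrite t1E /p /w ii0 mul1r mulrDr mulNr mulrN mulrA addrC.
exists theta1; split.
- move=> i; split; first exact: vector_field_derivation.
  move=> phi; rewrite inE t1E => /predU1P[->|ps].
    apply/(specialize_eq0 fb vX av); rewrite rmorphD !rmorphM /= qP /p /w.
    case: eqP => _; first by rewrite specialize_alpha // rmorph0 !mul0r addr0.
    by rewrite rmorph1 mul1r rmorphN /= sq mulNr subrr.
  have [g Dg] := (Dt i).2 _ ps; have [g0 Dg0] := (Dt i0).2 _ ps.
  exists (p i * g + w i * g0).
  by rewrite Dg Dg0 mulrDr; congr (_ + _); exact: mulrCA.
- move=> eta [De eP].
  have [|f Df] := gen_t eta; first by split=> // phi ps; apply: eP; rewrite inE ps orbT.
  have etaE g : eta g = \sum_i f i * theta i g.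
    rewrite (derivationE De) -vector_field_sum //; apply: eq_bigr => k _.
    by rewrite Df.
  pose S := \sum_i f i * q i.
  (* Modulo [a] the value [eta a] is [S] times the nonzero value of [theta i0]. Since [a] is prime
     and divides [eta a], it divides [S], and the quotient is the coefficient of [a * theta i0]. *)
  have [f0 Df0] : divides a S.
    have [|//|] := a_prime.2 S (theta i0 a); last first.
      by move/(specialize_eq0 fb vX av)/eqP; rewrite (negPf nz).
    have [g Dg] := eP _ (mem_head _ _).
    apply/(specialize_eq0 fb vX av); rewrite rmorphM /= rmorph_sum /= mulr_suml.
    transitivity (sigma (eta a)); last first.
      by rewrite Dg rmorphM /= specialize_alpha // mul0r.
    rewrite etaE rmorph_sum; apply: eq_bigr => i _.
    by rewrite !rmorphM /= sq (qP i) mulrA.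
  exists (fun i => if i == i0 then f0 else f i) => k.
  rewrite etaE sumE; apply: eq_bigr => i _; rewrite eqxx.
  case: eqP => [->|//]; congr (_ * _).
  rewrite -Df0 /S (bigD1 i0) //= q0 mulr1.
  rewrite [X in _ = _ - X](eq_bigr (fun j => f j * q j)) ?addrK // => j /negPf -> //.
- move=> f f0; have := ind_t (fun i => if i == i0 then a * f i0 - \sum_(j | j != i0) f j * q j else f i).
  move=> E; have {}E i := E (fun k => etrans (esym (sumE f 'X_k)) (f0 k)) i.
  have fne j : j != i0 -> f j = 0 by move=> /negPf ji; have := E j; rewrite ji.
  move=> i; have [->|/fne//] := eqVneq i i0.
  have := E i0; rewrite eqxx big1 => [|j /fne->]; last exact: mul0r.
  by rewrite subr0 => /eqP; rewrite mulf_eq0 (negPf a_prime.1) => /eqP.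
move=> i k; rewrite t1E /p /w; case: eqP => [->|_].
  rewrite mul0r addr0 -add1n; apply: dhomogM => //; exact: form_poly_homog.
rewrite mul1r rpredD // mulNr rpredN.
have [->|/qdeg le] := eqVneq (q i) 0; first by rewrite mul0r dhomog0.
by rewrite -(subnK le); apply: dhomogM.
Qed.

End Addition.

(** * Exponents, inductive freeness and the addition theorem *)

Lemma map_nth_enum_ord (T : Type) (x : T) (e : seq T) :
  [seq nth x e i | i : 'I_(size e) <- enum 'I_(size e)] = e.
Proof. by rewrite (map_comp (nth x e) (@nat_of_ord (size e))) val_enum_ord; apply: mkseq_nth. Qed.

Section InductiveFreeness.
Variables (R : fieldType) (V : vectType R).
Implicit Types (X H : {vspace V}) (phi : 'Hom(V, R^o)) (s : seq 'Hom(V, R^o))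
  (e : seq nat).

(** A permutation that matches [e] with the degrees is used to reindex the basis. *)
Lemma free_family_exponents X s (b : (\dim X).-tuple V) r (deg : 'I_r -> nat)
    theta e :
  {in s, forall phi, ~~ (X <= lker phi)%VS} -> basis_of X b ->
  free_family s b deg theta -> perm_eq e [seq deg i | i <- enum 'I_r] ->
  free_with_exponents (arr X s) e.
Proof.
move=> s0 bX [Dt gen_t ind_t hom_t].
have bspan : <<b>>%VS = X by case/andP: bX => /eqP.
rewrite (_ : [seq deg i | i <- enum 'I_r] = [tuple deg i | i < r]) //.
case/tuple_permP => p De; have sz : size e = r by rewrite De size_tuple.
pose q (i : 'I_(size e)) := p (cast_ord sz i).
have q_bij : bijective q.
  by apply: bij_comp; [exact: injF_bij perm_inj | exists (cast_ord (esym sz)); [exact: cast_ordK | exact: cast_ordKV]].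
have degq (i : 'I_(size e)) : nth 0%N e i = deg (q i).
  have isz : (i < r)%N by rewrite -sz.
  rewrite {1}De (nth_map (cast_ord sz i)) ?size_enum_ord // tnth_mktuple.
  by congr (deg (p _)); apply: val_inj; rewrite /= nth_enum_ord.
have [q' qK q'K] := q_bij.
have Dder i : is_derivation (theta i) by case: (Dt i).
exists b, (fun i => theta (q i)); split=> //; last by move=> i j; rewrite degq.
split=> [i|eta]; first exact/(log_derivationP _ bspan s0).
move=> /(log_derivationP _ bspan s0) eP; have [f Df] := gen_t _ eP.
have sumE (F : 'I_r -> {mpoly R[\dim X]}) g :
    \sum_i F (q i) * theta (q i) g = \sum_i F i * theta i g.
  by rewrite [RHS](reindex q) //; apply: onW_bij.
exists [ffun i => f (q i)]; split=> [g|F FP].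
  under eq_bigr do rewrite ffunE.
  rewrite sumE (derivationE eP.1) -vector_field_sum //.
  by apply: eq_bigr => k _; rewrite Df.
apply/ffunP => i; rewrite ffunE; apply/eqP; rewrite -subr_eq0; apply/eqP.
rewrite -{2}(qK i); move: {i}(q i); apply: ind_t => k.
under eq_bigr do rewrite mulrBl.
rewrite sumrB -Df FP -sumE; under [X in _ - X]eq_bigr do rewrite qK.
exact: subrr.
Qed.

Lemma exponents_free_family X s e :
  {in s, forall phi, ~~ (X <= lker phi)%VS} -> free_with_exponents (arr X s) e ->
  exists (b : (\dim X).-tuple V) theta,
    basis_of X b /\ free_family s b (fun i : 'I_(size e) => nth 0%N e i) theta.
Proof.
move=> s0 [b [theta [bX [Dt genP] hom_t]]]; exists b, theta; split=> //.
have bspan : <<b>>%VS = X by case/andP: bX => /eqP.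
have {}Dt i : logder s b (theta i) by apply/(log_derivationP _ bspan s0).
split=> // [eta /(log_derivationP _ bspan s0) /genP[f [Df _]]|f f0 i].
  by exists f => k; apply: Df.
(* Independence is the uniqueness of the coefficients of the zero derivation. *)
pose eta : {linear {mpoly R[\dim X]} -> {mpoly R[\dim X]}} := vector_field (fun=> 0).
have eta0 g : eta g = 0 by rewrite /= /vector_field big1 // => k _; rewrite mul0r.
have : logder s b eta.
  split; first exact: vector_field_derivation.
  by move=> phi _; exists 0; rewrite eta0 mulr0.
move=> /(log_derivationP _ bspan s0) /genP[h [_ hU]].
have h0 : h = [ffun=> 0].
  apply: hU => g; rewrite eta0 big1 // => j _; by rewrite ffunE mul0r.
have hf : h = [ffun j => f j].
  apply: hU => g; rewrite eta0.
  under eq_bigr do rewrite ffunE.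
  rewrite -vector_field_sum => [|j]; last by case: (Dt j).
  by rewrite /vector_field big1 // => k _; rewrite f0 mul0r.
by have := congr1 (fun F : {ffun _ -> _} => F i) (etrans (esym hf) h0); rewrite !ffunE.
Qed.

(** The count of hyperplanes is carried along because it yields the degree of the restriction
    polynomial in the addition theorem. *)
Definition ind_free (A : arrangement V) e : Prop :=
  [/\ inductively_free A, free_with_exponents A e & #|` planes A| = sumn e].

Lemma perm_sumn (e e' : seq nat) : perm_eq e e' -> sumn e = sumn e'.
Proof. by move=> p; rewrite !sumnE; apply: perm_big. Qed.

Lemma ind_free_perm X s e e' : {in s, forall phi, ~~ (X <= lker phi)%VS} ->
  perm_eq e e' -> ind_free (arr X s) e -> ind_free (arr X s) e'.
Proof.
move=> s0 ee' [indA freeA cardA]; split=> //; last by rewrite cardA (perm_sumn ee').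
have [b [theta [bX fam]]] := exponents_free_family s0 freeA.
apply: free_family_exponents s0 bX fam _; by rewrite map_nth_enum_ord perm_sym.
Qed.

(** Every derivation is logarithmic, and the partial derivatives form a basis of degree 0. *)
Lemma ind_free_empty X : ind_free (arr X [::]) (nseq (\dim X) 0%N).
Proof.
have p0 : planes (arr X [::]) = fset0.
  by apply/fsetP => K; rewrite inE; apply/mem_arr => -[].
split; last by rewrite p0 cardfs0 sumn_nseq mul0n.
  have -> : arr X [::] = Arrangement X fset0 by rewrite -p0.
  exact: inductively_free_empty.
pose d (i : 'I_(\dim X)) : {linear _ -> _} := @vector_field R (\dim X) (fun k => (k == i)%:R).
apply: (@free_family_exponents _ _ (vbasis X) (\dim X) (fun=> 0%N) d) => //.
- exact: vbasisP.
- have sumE (f : 'I_(\dim X) -> {mpoly R[\dim X]}) k : \sum_i f i * d i 'X_k = f k.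
    rewrite (bigD1 k) //= vector_fieldX eqxx mulr1 big1 ?addr0 // => i /negPf ik.
    by rewrite vector_fieldX eq_sym ik mulr0.
  split.
  + by move=> i; split=> //; apply: vector_field_derivation.
  + by move=> eta _; exists (fun k => eta 'X_k) => k; rewrite sumE.
  + by move=> f f0 i; rewrite -sumE f0.
  + move=> i k; rewrite [d i _]vector_fieldX; case: (k == i); last exact: dhomog0.
    exact: dhomog1.
rewrite -[X in nseq X _]size_enum_ord.
by rewrite (_ : nseq _ _ = [seq 0%N | _ <- enum 'I_(\dim X)]) //; elim: (enum _) => //= ? ? ->.
Qed.

Lemma deletion_arr X s alpha :
  let H := (X :&: lker alpha)%VS in
  {in s, forall phi, ~~ (H <= lker phi)%VS} ->
  deletion (arr X (alpha :: s)) H = arr X s.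
Proof.
move=> H sH; congr Arrangement; apply/fsetP => K; rewrite in_fsetD1.
apply/andP/mem_arr => [[KH /mem_arr[phi]]|[phi ps DK]].
  rewrite inE => /predU1P[->|ps] DK; last by exists phi.
  by rewrite DK eqxx in KH.
split; last by apply/mem_arr; exists phi; rewrite // inE ps orbT.
by apply: contraNneq (sH _ ps) => <-; rewrite DK capvSr.
Qed.

Lemma restriction_arr X Y s : (Y <= X)%VS ->
  restriction (arr X s) Y = arr Y [seq phi <- s | ~~ (Y <= lker phi)%VS].
Proof.
move=> YX; congr Arrangement; apply/fsetP => K.
have traceE phi : (X :&: lker phi :&: Y = Y :&: lker phi)%VS.
  by rewrite capvC capvA (capv_idPl YX).
have subE phi : (Y <= X :&: lker phi)%VS = (Y <= lker phi)%VS by rewrite subv_cap YX.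
apply/imfsetP/mem_arr => [[L]|[phi]].
  rewrite !inE /= => /andP[/mem_arr[phi ps ->]]; rewrite subE => Yphi ->.
  by exists phi; rewrite ?mem_filter ?Yphi.
rewrite mem_filter => /andP[Yphi ps] ->; exists (X :&: lker phi)%VS => //.
by rewrite !inE subE Yphi andbT; apply/mem_arr; exists phi.
Qed.

Lemma ind_free_add X s alpha c e1 e2 e3 :
  let H := (X :&: lker alpha)%VS in
  ~~ (X <= lker alpha)%VS -> {in s, forall phi, ~~ (H <= lker phi)%VS} ->
  ind_free (arr X s) e2 -> ind_free (arr H s) e1 ->
  perm_eq e2 (c :: e1) -> perm_eq e3 (c.+1 :: e1) ->
  ind_free (arr X (alpha :: s)) e3.
Proof.
move=> H a0 sH [ind2 free2 card2] [ind1 free1 card1] pe2 pe3.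
have s0 phi : phi \in s -> ~~ (X <= lker phi)%VS.
  by move=> /sH; apply: contraNN; apply: subv_trans; apply: capvSl.
have delE := deletion_arr sH.
have resE : restriction (arr X (alpha :: s)) H = arr H s.
  rewrite restriction_arr ?capvSl //= capvSr /=; congr arr.
  by apply/all_filterP/allP.
have HA : H \in planes (arr X (alpha :: s)).
  by apply/mem_arr; exists alpha; rewrite ?mem_head.
split.
- apply: (inductively_free_add HA (e1 := e1) (e2 := e2)); rewrite ?delE ?resE //.
  by move=> x; rewrite (seq.permP pe2) /= leq_addl.
- have [b [theta [bX fam]]] := exponents_free_family s0 free2.
  have [b' [theta' [bH fam']]] := exponents_free_family sH free1.
  have [/eqP bspan fb] := andP bX; have [/eqP bspan' fb'] := andP bH.
  have [v vX av] := exists_eq1 a0.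
  (* With both counts equal to sums of exponents, the restriction polynomial has degree [c]. *)
  have cardH : (#|` planes (arr X s)| - #|` planes (arr H s)|)%N = c.
    by rewrite card1 card2 (perm_sumn pe2) /= addnK.
  have vb : v \in <<b>>%VS by rewrite bspan.
  have sHb : {in s, forall phi, ~~ (<<b>> :&: lker alpha <= lker phi)%VS}.
    by rewrite bspan.
  have countE e : #|[pred j : 'I_(size e) | (nth 0 e j <= c)%N]| = count (leq^~ c) e.
    by rewrite cardE /enum_mem size_filter -enumT -[in RHS](map_nth_enum_ord 0%N e) count_map.
  (* One more exponent of [e2] than of [e1] is at most [c], which produces [i0]. *)
  have [||i0 i0c nz] := @exists_nonvanishing _ _ _ _ _ _ _ fb vb av sHb _ _ _ fam
      _ _ _ _ _ fb' _ fam' c; first by rewrite bspan' bspan.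
    by rewrite !countE (seq.permP pe2) /= leqnn add1n.
  have [Dt _ _ hom_t] := fam.
  pose B := restriction_poly X b s alpha v.
  have Bhom : B \is c.-homog by rewrite -cardH; apply: restriction_poly_homog.
  pose pb := map_tuple (projection alpha v) b.
  pose t i := change_vars b pb (theta i (form_poly b alpha)).
  have thom i : t i \is (nth 0%N e2 i).-homog.
    exact/change_vars_homog/derivation_form_homog.
  have /fin_all_exists[q0 Dq0] i : exists q0, [/\ t i = q0 * B,
      q0 != 0 -> (c <= nth 0%N e2 i)%N & q0 \is (nth 0%N e2 i - c).-homog].
    have [g Dg] := restriction_poly_divides fb bspan vX av sH (Dt i).
    have Dti : t i = pihomog mdeg (nth 0%N e2 i) (g * B).
      by rewrite mulrC -[B * g]Dg pihomog_dE ?thom //; exact: thom.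
    move: Dti; rewrite (pihomogM _ _ Bhom); case: leqP => ce Dti.
      by exists (pihomog mdeg (nth 0%N e2 i - c) g); split=> //; apply: pihomogP.
    by exists 0; split; rewrite ?dhomog0 ?eqxx.
  have [Dt0 c_le q0_hom] := Dq0 i0.
  have q00 : q0 i0 != 0 by apply: contraNneq nz => q00; rewrite -/(t i0) Dt0 q00 mul0r.
  (* A nonzero multiple of [B] has degree at least [c], so the degree of [theta i0] is exactly [c]
     and its quotient by [B] is a constant [k]. *)
  have Dc : nth 0%N e2 i0 = c by apply/eqP; rewrite eqn_leq i0c c_le.
  rewrite Dc subnn in q0_hom; move: Dt0 q00; rewrite (dhomog0_const q0_hom).
  set k := (q0 i0)@_0; rewrite mpolyC_eq0 => Dt0 k0.
  have [||||theta1 fam1] := free_family_add fb vb av fam (i0 := i0)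
      (q := fun i => k^-1 *: q0 i).
  + exact: nz.
  + move=> i; have [Dti _ _] := Dq0 i; rewrite -/(t i) -/(t i0) Dti Dt0.
    by rewrite mul_mpolyC -scalerAl -scalerAr scalerA mulVf ?scale1r.
  + move=> i; rewrite scaler_eq0 invr_eq0 (negPf k0) /= Dc; by case: (Dq0 i).
  + by move=> i; rewrite Dc; apply: rpredZ; case: (Dq0 i).
  apply: (free_family_exponents _ bX fam1).
    by move=> phi; rewrite inE => /predU1P[->//|/s0].
  rewrite (permPl pe3) perm_sym Dc.
  have pi0 := perm_to_rem (mem_enum 'I_(size e2) i0).
  rewrite (permPl (perm_map _ pi0)) /= eqxx perm_cons.
  have : perm_eq e2 (c :: [seq nth 0%N e2 i | i : 'I_(size e2) <- rem i0 (enum 'I_(size e2))]).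
    by rewrite -{1}(map_nth_enum_ord 0%N e2) (permPl (perm_map _ pi0)) /= Dc.
  rewrite (permPl pe2) perm_cons perm_sym => /(perm_trans _); apply.
  rewrite (@eq_in_map _ _ _ (fun i : 'I_(size e2) => nth 0%N e2 i) _).1 // => i.
  by rewrite mem_rem_uniq ?enum_uniq // inE => /andP[/negPf->].
rewrite (cardfsD1 H) HA; have := congr1 (fun A => #|` planes A|) delE.
by rewrite /= => ->; rewrite card2 (perm_sumn pe2) (perm_sumn pe3).
Qed.

End InductiveFreeness.

(** * Cones of affine arrangements of points and differences *)

Section Restrictions.
Variables (R : fieldType) (V : vectType R).
Implicit Types (X : {vspace V}) (s : seq 'Hom(V, R^o)).

Lemma eq_arr X s1 s2 :
  {in s1, forall phi, exists2 psi, psi \in s2 & (X :&: lker phi = X :&: lker psi)%VS} ->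
  {in s2, forall phi, exists2 psi, psi \in s1 & (X :&: lker phi = X :&: lker psi)%VS} ->
  arr X s1 = arr X s2.
Proof.
move=> s12 s21; congr Arrangement; apply/fsetP => K.
by apply/mem_arr/mem_arr => -[phi ps ->]; [have [psi] := s12 _ ps | have [psi] := s21 _ ps]; exists psi.
Qed.

Lemma sub_lkerE X (phi : 'Hom(V, R^o)) : (X <= lker phi)%VS = (X :&: lker phi == X)%VS.
Proof. by apply/capv_idPl/eqP. Qed.

(** The addition theorem in the form used below: the restriction is described by a list [s'] of its
    own, in which forms of [s] may have been simplified or identified. *)
Lemma ind_free_add_restr X alpha s s' c e1 e2 e3 :
  let H := (X :&: lker alpha)%VS in
  ~~ (X <= lker alpha)%VS -> {in s', forall phi, ~~ (H <= lker phi)%VS} ->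
  {in s, forall phi, exists2 psi, psi \in s' & (H :&: lker phi = H :&: lker psi)%VS} ->
  {in s', forall phi, exists2 psi, psi \in s & (H :&: lker phi = H :&: lker psi)%VS} ->
  ind_free (arr X s) e2 -> ind_free (arr H s') e1 ->
  perm_eq e2 (c :: e1) -> perm_eq e3 (c.+1 :: e1) ->
  ind_free (arr X (alpha :: s)) e3.
Proof.
move=> H a0 s'0 ss' s's; rewrite -(eq_arr ss' s's); apply: ind_free_add => // phi.
by move=> /ss'[psi /s'0]; rewrite !sub_lkerE => + ->.
Qed.

Lemma dim_lker_cap X (phi : 'Hom(V, R^o)) :
  ~~ (X <= lker phi)%VS -> (\dim (X :&: lker phi)).+1 = \dim X.
Proof.
move=> X0; rewrite -(limg_ker_dim phi X) -addn1; congr (_ + _)%N.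
apply/esym/eqP; rewrite eqn_leq lt0n dimv_eq0; apply/andP; split.
  by have := dimvS (subvf (phi @: X)); rewrite dimvf.
by apply: contraNneq X0 => X0; rewrite lkerE X0.
Qed.

End Restrictions.

(* None, Some (inl (i, s)) and Some (inr (i, j, t)) stand for the hyperplanes
   z = 0, x_i = s z and x_i - x_j = t z. *)
Definition code : Type := option (nat * int + nat * nat * int).
Definition code_eqType : eqType := code.
Local Notation Pt i s := (Some (inl (i, s)) : code).
Local Notation Df i j t := (Some (inr (i, j, t)) : code).

(** The index set is arbitrary because restricting to a point of a coordinate removes an index from
    it. *)
Definition coneA (I : seq nat) (n : nat) (N : nat -> seq int) : seq code_eqType :=
  let pairs := [seq ij : nat * nat <- [seq (i, j) | i <- I, j <- I] | (ij.1 < ij.2)%N] in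
  None :: [seq Df ij.1 ij.2 0 | ij <- pairs]
       ++ [seq Df ij.1 ij.2 1 | ij : nat * nat <- pairs & (ij.2 <= n)%N]
       ++ [seq Pt i s | i <- I, s <- N i].

Lemma mem_coneA I n N (c : code_eqType) :
  (c \in coneA I n N) =
  match c with
  | None => true
  | Some (inl (i, s)) => (i \in I) && (s \in N i)
  | Some (inr (i, j, t)) =>
      [&& i \in I, j \in I, (i < j)%N & (t == 0) || (t == 1) && (j <= n)%N]
  end.
Proof.
rewrite inE !mem_cat; case: c => [[[i s]|[[i j] t]]|//] /=.
- apply/orP/andP => [[/mapP[] //|/orP[/mapP[] //|]]|[iI sN]].
    by case/allpairsPdep => i' [s' [iI sN [-> ->]]].
  by right; apply/orP; right; apply/allpairsPdep; exists i, s.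
have pairsP : ((i, j) \in [seq ij : nat * nat <- [seq (i, j) | i <- I, j <- I] | (ij.1 < ij.2)%N])
    = [&& i \in I, j \in I & (i < j)%N].
  rewrite mem_filter /= andbC [RHS]andbA; congr (_ && _).
  by apply/allpairsP/andP => [[[i' j'] /= [iI jI [-> ->]]]|[iI jI]] //; exists (i, j).
apply/orP/and4P => [[/mapP[[i' j'] + [Di Dj ->]]|/orP[/mapP[[i' j'] + [Di Dj ->]]|]]|].
- by rewrite -{}Di -{}Dj pairsP => /and3P[].
- by rewrite -{}Di -{}Dj mem_filter pairsP => /andP[-> /and3P[]].
- by case/allpairsPdep => ? [? []].
move=> [iI jI ij /orP[/eqP->|/andP[/eqP-> jn]]].
  by left; apply/mapP; exists (i, j); rewrite // pairsP iI jI ij.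
right; apply/orP; left; apply/mapP; exists (i, j) => //.
by rewrite mem_filter pairsP iI jI ij jn.
Qed.

Section Cones.
Variables (R : numFieldType) (V : vectType R) (z : 'Hom(V, R^o)).
Implicit Types (X : {vspace V}) (x : nat -> 'Hom(V, R^o)) (c : code_eqType)
  (I : seq nat) (N : nat -> seq int).

Definition ev x c : 'Hom(V, R^o) :=
  match c with
  | None => z
  | Some (inl (i, s)) => x i - s%:~R *: z
  | Some (inr (i, j, t)) => x i - x j - t%:~R *: z
  end.

Lemma evE x c v : ev x c v =
  match c with
  | None => z v
  | Some (inl (i, s)) => x i v - s%:~R * z v
  | Some (inr (i, j, t)) => x i v - x j v - t%:~R * z v
  end.
Proof.
by case: c => [[[i s]|[[i j] t]]|//]; rewrite /ev !add_lfunE !opp_lfunE scale_lfunE.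
Qed.

Arguments ev : simpl never.

(** Linear independence of [z] and the [x i] on [X], phrased by prescribing values, which passes
    easily to the hyperplanes below. *)
Definition independent X x I : Prop := forall (c : nat -> R) (cz : R),
  exists2 v, v \in X & z v = cz /\ {in I, forall i, x i v = c i}.

Lemma independentS X x I I' : {subset I' <= I} -> independent X x I ->
  independent X x I'.
Proof.
move=> sI indI c cz; have [v vX [vz vx]] := indI c cz.
by exists v => //; split=> // i /sI /vx.
Qed.

Lemma ev_nonzero X x I n N c :
  independent X x I -> c \in coneA I n N -> ~~ (X <= lker (ev x c))%VS.
Proof.
rewrite mem_coneA => ind cI; apply/subvPn.
case: c cI => [[[i s]|[[i j] t]]|] /= cI.
- have [v vX [vz vx]] := ind (fun=> 1) 0; exists v => //.
  by rewrite memv_ker evE vz mulr0 subr0 vx ?oner_eq0 //; case/andP: cI.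
- have [v vX [vz vx]] := ind (fun k => (k == i)%:R) 0; exists v => //.
  case/and4P: cI => iI jI ij _; rewrite memv_ker evE vz mulr0 subr0 !vx //.
  by rewrite eqxx (gtn_eqF ij) subr0 oner_eq0.
by have [v vX [vz vx]] := ind (fun=> 1) 1; exists v; rewrite // memv_ker evE vz oner_eq0.
Qed.

Lemma ev_nonzero_all X x I n N : independent X x I ->
  {in map (ev x) (coneA I n N), forall phi, ~~ (X <= lker phi)%VS}.
Proof. by move=> ind _ /mapP[c cI ->]; apply: ev_nonzero ind cI. Qed.

Lemma lker_cap_eq X (phi psi : 'Hom(V, R^o)) (a : R) : a != 0 -> {in X, phi =1 a *: psi} ->
  (X :&: lker phi = X :&: lker psi)%VS.
Proof.
move=> a0 E; apply/vspaceP => v; rewrite !memv_cap !memv_ker.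
by case vX: (v \in X) => //=; rewrite E // scale_lfunE [_ == 0]mulf_eq0 (negPf a0).
Qed.

(** Quantifying over the space and the forms makes the property applicable to restrictions and after
    a change of coordinates. The [k] excess dimensions contribute exponents 0. *)
Definition cone_ind_free I n N (e : seq nat) : Prop := forall X x k,
  independent X x I -> \dim X = ((size I).+1 + k)%N ->
  ind_free (arr X (map (ev x) (coneA I n N))) (e ++ nseq k 0%N).

Lemma cone_ind_free_perm I n N e e' : perm_eq e e' -> cone_ind_free I n N e -> cone_ind_free I n N e'.
Proof.
move=> ee' G X x k ind dX; apply: ind_free_perm (G _ _ _ ind dX); last by rewrite perm_cat2r.
exact: ev_nonzero_all ind.
Qed.

Lemma eq_arr_codes X x (cs cs' : seq code_eqType) : cs =i cs' ->
  arr X (map (ev x) cs) = arr X (map (ev x) cs').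
Proof.
move=> E; apply: eq_arr => _ /mapP[c cI ->]; exists (ev x c) => //; apply: map_f.
  by rewrite -E.
by rewrite E.
Qed.

Lemma eq_cone_ind_free I n N N' e : {in I, forall i, N i =i N' i} -> cone_ind_free I n N e -> cone_ind_free I n N' e.
Proof.
move=> E G X x k ind dX; rewrite -(@eq_arr_codes _ _ (coneA I n N)); first exact: G.
move=> c; rewrite !mem_coneA; case: c => [[[i s]|[[i j] t]]|] //.
by case iI: (i \in I) => //=; apply: E.
Qed.

Lemma cone_ind_free_nil n N : cone_ind_free [::] n N [:: 1%N].
Proof.
move=> X x k ind dX; have z0 : ~~ (X <= lker z)%VS by apply: (ev_nonzero (n := n) (N := N) (c := None) ind).
have dH := dim_lker_cap z0.
have kE : \dim (X :&: lker z) = k by apply: succn_inj; rewrite dH dX.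
apply: (ind_free_add (c := 0%N) (e1 := nseq k 0%N) (e2 := nseq (\dim X) 0%N)) => //.
- exact: ind_free_empty.
- by rewrite -[in nseq k _]kE; apply: ind_free_empty.
by rewrite dX.
Qed.

Lemma memH X (phi : 'Hom(V, R^o)) v : v \in (X :&: lker phi)%VS -> v \in X /\ phi v = 0.
Proof. by rewrite memv_cap memv_ker => /andP[-> /eqP]. Qed.

(** On [x i0 = a z] a difference with [x i0] becomes a point of the other coordinate: [a] or [a + 1]
    for a smaller index, [a] or [a - 1] for a larger one. The points of [x i0] all become
    [z = 0]. *)
Lemma cone_ind_free_add_point I n N N1 N2 i0 (a : int) (b : nat) e1 :
  i0 \in I -> uniq I -> {in I, forall i, (i <= n)%N} -> a \notin N i0 ->
  {in I, forall i, N1 i =i [pred s | (s \in N i) || (i == i0) && (s == a)]} ->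
  {in rem i0 I, forall i, N2 i =i [pred s | [|| s \in N i, s == a |
      s == (if (i < i0)%N then a + 1 else a - 1)]]} ->
  cone_ind_free I n N (b :: e1) -> cone_ind_free (rem i0 I) n N2 e1 -> cone_ind_free I n N1 (b.+1 :: e1).
Proof.
move=> i0I uI In aN N1E N2E G G' X x k ind dX.
have remI i : (i \in rem i0 I) = (i != i0) && (i \in I) by rewrite mem_rem_uniq // inE.
pose H := (X :&: lker (ev x (Pt i0 a)))%VS.
have alpha0 : ~~ (X <= lker (ev x (Pt i0 a)))%VS.
  by apply: (ev_nonzero (n := n) (N := fun=> [:: a]) ind); rewrite mem_coneA i0I mem_head.
have HE v : v \in H -> x i0 v = a%:~R * z v.
  by move=> /memH[_]; rewrite evE => /subr0_eq.
have indH : independent H x (rem i0 I).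
  move=> f fz; have [v vX [vz vx]] := ind (fun i => if i == i0 then a%:~R * fz else f i) fz.
  exists v; first by rewrite memv_cap vX memv_ker evE vx // eqxx vz subrr eqxx.
  split=> // i; rewrite remI => /andP[/negPf ii0 iI]; by rewrite vx // ii0.
have dH : \dim H = ((size (rem i0 I)).+1 + k)%N.
  apply: succn_inj; rewrite dim_lker_cap // dX size_rem // prednK //.
  by case: (I) i0I.
(* [rho] gives the hyperplane cut out on [H], after elimination of [x i0]. *)
pose rho (d : code_eqType) : code_eqType := match d with
  | None => None
  | Some (inl (i, s)) => if i == i0 then None else Pt i s
  | Some (inr (i, j, t)) => if i == i0 then Pt j (a - t)
                            else if j == i0 then Pt i (a + t) else Df i j t
  end.
have rhoE d : d \in coneA I n N -> (H :&: lker (ev x d) = H :&: lker (ev x (rho d)))%VS.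
  rewrite mem_coneA; case: d => [[[i s]|[[i j] t]]|] //=.
    case: eqP => [->|//] /andP[_ sN].
    apply: (@lker_cap_eq _ _ _ (a - s)%:~R) => [|v vH].
      by rewrite intr_eq0 subr_eq0; apply: contraNneq aN => ->.
    by rewrite (evE x (Pt i0 s)) HE // scale_lfunE rmorphB -mulrBl.
  move=> _; case: eqP => [->|_].
    apply: (@lker_cap_eq _ _ _ (-1)) => [|v vH]; first by rewrite oppr_eq0 oner_eq0.
    rewrite (evE x (Df i0 j t)) HE // scale_lfunE (evE x (Pt j _)) [_ *: _]mulN1r rmorphB.
    by rewrite /=; ring.
  case: eqP => [->|//].
  apply: (@lker_cap_eq _ _ _ 1) => [|v vH]; first by rewrite oner_eq0.
  by rewrite (evE x (Df i i0 t)) HE // scale1r (evE x (Pt i _)) rmorphD; ring.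
have rhoI d : d \in coneA I n N -> rho d \in coneA (rem i0 I) n N2.
  rewrite !mem_coneA; case: d => [[[i s]|[[i j] t]]|] //=.
    case: eqP => [//|/eqP ii0 /andP[iI sN]].
    by rewrite remI ii0 iI N2E ?remI ?ii0 // inE sN.
  case/and4P=> iI jI ij tP; case: eqP => [Di|/eqP ii0].
    have jr : j \in rem i0 I by rewrite remI jI andbT -Di gtn_eqF.
    rewrite jr N2E // inE -Di ltnNge ltnW //=.
    by case/orP: tP => [/eqP->|/andP[/eqP-> _]]; rewrite ?subr0 eqxx ?orbT.
  case: eqP => [Dj|/eqP ji0]; last by rewrite !remI ii0 ji0 iI jI ij.
  have ir : i \in rem i0 I by rewrite remI iI ii0.
  rewrite ir N2E // inE -Dj ij.
  by case/orP: tP => [/eqP->|/andP[/eqP-> _]]; rewrite ?addr0 eqxx ?orbT.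
have rho_onto d' : d' \in coneA (rem i0 I) n N2 ->
    exists2 d, d \in coneA I n N & rho d = d'.
  rewrite mem_coneA; case: d' => [[[i s]|[[i j] t]]|] /=; last by exists None.
    move=> /andP[ir]; rewrite N2E // inE; move: ir; rewrite remI => /andP[/negPf ii0 iI].
    case/or3P => [sN|/eqP->|/eqP->].
    - by exists (Pt i s); rewrite /= ?ii0 // mem_coneA iI sN.
    - have := ii0; case: (ltngtP i i0) => // ii _.
        by exists (Df i i0 0); rewrite /= ?ii0 ?eqxx ?addr0 // mem_coneA iI i0I ii.
      by exists (Df i0 i 0); rewrite /= ?eqxx ?subr0 // mem_coneA iI i0I ii.
    have := ii0; case: (ltngtP i i0) => // ii _.
      by exists (Df i i0 1); rewrite /= ?ii0 ?eqxx // mem_coneA iI i0I ii In.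
    by exists (Df i0 i 1); rewrite /= ?eqxx // mem_coneA iI i0I ii In.
  rewrite !remI => /and4P[/andP[ii0 iI] /andP[ji0 jI] ij tP].
  by exists (Df i j t); rewrite /= ?(negPf ii0) ?(negPf ji0) // mem_coneA iI jI ij.
rewrite (@eq_arr_codes _ _ _ ((Pt i0 a : code_eqType) :: coneA I n N)); last first.
  move=> d; rewrite inE !mem_coneA; case: d => [[[i s]|[[i j] t]]|] //=.
  rewrite (_ : (Pt i s == Pt i0 a) = (i == i0) && (s == a)) //.
  have [->|ii0] := eqVneq i i0; first by rewrite i0I N1E // inE eqxx orbC.
  by case iI: (i \in I) => //=; rewrite N1E // inE (negPf ii0) orbF.
apply: (@ind_free_add_restr _ _ _ (ev x (Pt i0 a)) (map (ev x) (coneA I n N))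
    (map (ev x) (coneA (rem i0 I) n N2)) b
    (e1 ++ nseq k 0%N) ((b :: e1) ++ nseq k 0%N)) => //.
- exact: ev_nonzero_all indH.
- move=> _ /mapP[d dI ->]; exists (ev x (rho d)); last exact: rhoE.
  by rewrite map_f ?rhoI.
- move=> _ /mapP[_ /rho_onto[d dI <-] ->]; exists (ev x d); last exact: esym (rhoE _ dI).
  exact: map_f.
- exact: G.
exact: G'.
Qed.

(** The points of [i0] belong to every other coordinate, and differences with [x i0] are only
    equated to 0 because [n < i0]. Hence any two hyperplanes that involve [x i0] meet inside one
    that does not, and restricting to any of them gives the arrangement without [x i0]. *)
Lemma cone_ind_free_add_coordinate I n N i0 e :
  uniq I -> {in I, forall i, (i < i0)%N} -> (n < i0)%N -> uniq (N i0) ->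
  {in I, forall i, {subset N i0 <= N i}} ->
  cone_ind_free I n N e -> cone_ind_free (rcons I i0) n N ((size (N i0) + size I)%N :: e).
Proof.
move=> uI Ii0 ni0 uN NN G X x k ind dX.
have i0I : i0 \notin I by apply/negP => /Ii0; rewrite ltnn.
pose L : seq code_eqType := [seq Pt i0 s | s <- N i0] ++ [seq Df j i0 0 | j <- I].
have LP d : d \in L -> (exists2 s, s \in N i0 & d = Pt i0 s)
    \/ (exists2 j, j \in I & d = Df j i0 0).
  by rewrite /L mem_cat => /orP[] /mapP[y yN ->]; [left|right]; exists y.
have LI d : d \in L -> d \in coneA (rcons I i0) n N.
  rewrite mem_coneA => /LP[[s sN ->]|[j jI ->]].
    by rewrite mem_rcons mem_head sN.
  by rewrite !mem_rcons mem_head inE jI orbT Ii0.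
have uL : uniq L.
  rewrite /L cat_uniq !map_inj_uniq ?uN ?uI ?andbT /=; try by move=> ? ? [].
  by apply/hasPn => _ /mapP[j jI ->]; apply/mapP => -[].
have sL : size L = (size (N i0) + size I)%N by rewrite /L size_cat !size_map.
have -> : arr X (map (ev x) (coneA (rcons I i0) n N))
    = arr X (map (ev x) (L ++ coneA I n N)).
  apply: eq_arr_codes => d; rewrite mem_cat; apply/idP/orP => [|[/LI//|]].
    rewrite !mem_coneA; case: d => [[[i s]|[[i j] t]]|]; rewrite /= ?mem_rcons ?inE.
    + case: eqP => [-> /= sN|_ /= ->]; last by right.
      by left; rewrite /L mem_cat map_f.
    + case/and4P => /predU1P[Di|iI] /predU1P[Dj|jI] ij tP.
      * by rewrite Di Dj ltnn in ij.
      * by rewrite Di in ij; have := Ii0 _ jI; rewrite ltnNge ltnW.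
      * left; rewrite Dj leqNgt ni0 /= andbF orbF in tP; rewrite (eqP tP) Dj /L mem_cat.
        by apply/orP; right; apply/mapP; exists i.
      * by right; rewrite iI jI ij.
    + by right.
  rewrite !mem_coneA; case: d => [[[i s]|[[i j] t]]|] //=; rewrite ?mem_rcons ?inE.
    by move=> /andP[-> ->]; rewrite orbT.
  by move=> /and4P[-> -> -> ->]; rewrite !orbT.
(* The hyperplanes that involve [x i0] are added one by one, and only the first exponent grows. *)
rewrite -sL; suff gen (L' : seq code_eqType) : uniq L' -> {subset L' <= L} ->
    ind_free (arr X (map (ev x) (L' ++ coneA I n N))) ((size L' :: e) ++ nseq k 0%N).
  exact: gen.
elim: L' => [_ _|d L' IHL /= /andP[dL' uL'] subL].
  (* Before any of them is added, [x i0] is an excess dimension with exponent 0. *)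
  apply: ind_free_perm; last first.
  - apply: (G X x k.+1); last by rewrite dX size_rcons addSnnS.
    by apply: independentS ind => i iI; rewrite mem_rcons inE iI orbT.
  - by rewrite /= -(perm_catCA [:: 0%N]).
  apply: (@ev_nonzero_all _ _ I); apply: independentS ind => i iI.
  by rewrite mem_rcons inE iI orbT.
have dL : d \in L by apply: subL; apply: mem_head.
have d0 : ~~ (X <= lker (ev x d))%VS by apply: (ev_nonzero ind); apply: LI dL.
pose H := (X :&: lker (ev x d))%VS.
have indH : independent H x I.
  move=> f fz; case: (LP _ dL) => [[s sN Dd]|[j jI Dd]].
    have [v vX [vz vx]] := ind (fun i => if i == i0 then s%:~R * fz else f i) fz.
    exists v.
      by rewrite memv_cap vX memv_ker evE Dd vx ?mem_rcons ?mem_head // eqxx vz subrr eqxx.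
    split=> // i iI; rewrite vx ?mem_rcons ?inE ?iI ?orbT //.
    by case: eqP => // Di; rewrite -Di iI in i0I.
  have [v vX [vz vx]] := ind (fun i => if i == i0 then f j else f i) fz.
  have ji0 : (j == i0) = false by apply/negP => /eqP Dj; rewrite -Dj jI in i0I.
  exists v.
    rewrite memv_cap vX memv_ker evE Dd !vx ?mem_rcons ?mem_head ?inE ?jI ?orbT //.
    by rewrite eqxx ji0 subrr mul0r subr0 eqxx.
  split=> // i iI; rewrite vx ?mem_rcons ?inE ?iI ?orbT //.
  by case: eqP => // Di; rewrite -Di iI in i0I.
apply: (@ind_free_add_restr _ _ _ (ev x d) (map (ev x) (L' ++ coneA I n N))
    (map (ev x) (coneA I n N)) (size L')
    (e ++ nseq k 0%N) ((size L' :: e) ++ nseq k 0%N)) => //.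
- exact: ev_nonzero_all indH.
- move=> _ /mapP[d' + ->]; rewrite mem_cat => /orP[d'L|d'I]; last by exists (ev x d'); rewrite ?map_f.
  have dd' : d' != d by apply: contraNneq dL' => <-.
  (* Eliminating [x i0] between [d] and [d'] leads to a hyperplane that is already present. *)
  suff [d'' d''I [a a0 aE]] : exists2 d'', d'' \in coneA I n N &
      exists2 a, a != 0 & {in H, forall v, ev x d' v = a * ev x d'' v}.
    exists (ev x d''); first exact: map_f.
    by apply: lker_cap_eq a0 _ => v vH; rewrite aE // scale_lfunE.
  have d'LL : d' \in L by apply: subL; rewrite inE d'L orbT.
  case: (LP _ dL) => [[s sN Dd]|[j jI Dd]].
    have HE v : v \in H -> x i0 v = s%:~R * z v.
      by rewrite /H Dd => /memH[_]; rewrite evE => /subr0_eq.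
    case: (LP _ d'LL) => [[s' s'N Dd']|[j jI ->]].
      exists None; first by rewrite mem_coneA.
      exists (s - s')%:~R => [|v vH].
        rewrite intr_eq0 subr_eq0; apply: contraNneq dd' => ss'.
        by rewrite Dd Dd' ss'.
      by rewrite Dd' !evE HE // rmorphB mulrBl.
    exists (Pt j s); first by rewrite mem_coneA jI NN.
    exists 1 => [|v vH]; first exact: oner_neq0.
    by rewrite !evE HE // mul0r subr0 mul1r.
  have HE v : v \in H -> x i0 v = x j v.
    rewrite /H Dd => /memH[_]; rewrite evE mul0r subr0 => /subr0_eq ->//.
  case: (LP _ d'LL) => [[s' s'N ->]|[j' j'I Dd']].
    exists (Pt j s'); first by rewrite mem_coneA jI NN.
    exists 1 => [|v vH]; first exact: oner_neq0.
    by rewrite !evE HE // mul1r.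
  case: (ltngtP j j') => jj'.
  + exists (Df j j' 0); first by rewrite mem_coneA jI j'I jj'.
    exists (-1) => [|v vH]; first by rewrite oppr_eq0 oner_neq0.
    by rewrite Dd' !evE HE // !mul0r !subr0 mulN1r opprB.
  + exists (Df j' j 0); first by rewrite mem_coneA jI j'I jj'.
    exists 1 => [|v vH]; first exact: oner_neq0.
    by rewrite Dd' !evE HE // mul1r.
  by case/eqP: dd'; rewrite Dd Dd' jj'.
- move=> _ /mapP[d' d'I ->]; exists (ev x d') => //.
  by rewrite map_f // mem_cat d'I orbT.
- by apply: IHL => // d' d'L; apply: subL; rewrite inE d'L orbT.
apply: G => //; apply: succn_inj; rewrite dim_lker_cap // dX size_rcons.
by rewrite addSn.
Qed.

(* Differences with the last coordinate turn the arrangement x_i - x_j = 0, 1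
   into one with one coordinate less and the points 0 and 1. *)
Lemma cone_ind_free_translate I n N N1 m e :
  {in I, forall i, (i < m)%N} -> (m <= n)%N ->
  {in I, forall i, N i =i [:: 0; 1]} -> (forall i, N1 i = [::]) ->
  cone_ind_free I n N e -> cone_ind_free (rcons I m) n N1 (0%N :: e).
Proof.
move=> Im mn NE N1E G X x k ind dX.
have mI : m \notin I by apply/negP => /Im; rewrite ltnn.
pose x' i := x i - x m.
have ind' : independent X x' I.
  move=> f fz; have [v vX [vz vx]] := ind (fun i => if i == m then 0 else f i) fz.
  exists v => //; split=> // i iI; rewrite /x' add_lfunE opp_lfunE.
  rewrite !vx ?mem_rcons ?mem_head // ?inE ?iI ?orbT // eqxx subr0.
  by case: eqP => // Di; rewrite -Di iI in mI.
have Df' i j t : ev x' (Df i j t) = ev x (Df i j t).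
  by rewrite /ev /x' opprB addrA subrK.
have Pt' i s : ev x' (Pt i s) = ev x (Df i m s) by [].
have -> : arr X (map (ev x) (coneA (rcons I m) n N1)) = arr X (map (ev x') (coneA I n N)).
  apply: eq_arr => _ /mapP[d + ->]; rewrite mem_coneA.
    case: d => [[[i s]|[[i j] t]]|].
    - by rewrite N1E andbF.
    - rewrite !mem_rcons !inE => /and4P[/predU1P[Di|iI] /predU1P[Dj|jI] ij tP].
      + by rewrite Di Dj ltnn in ij.
      + by rewrite Di in ij; have := Im _ jI; rewrite ltnNge ltnW.
      + exists (ev x' (Pt i t)); last by rewrite Pt' Dj.
        rewrite map_f // mem_coneA iI NE // !inE.
        by case/orP: tP => [->//|/andP[->]]; rewrite orbT.
      + exists (ev x' (Df i j t)); last by rewrite Df'.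
        by rewrite map_f // mem_coneA iI jI ij.
    - by exists (ev x' None) => //; rewrite map_f // mem_coneA.
  case: d => [[[i s]|[[i j] t]]|].
  - move=> /andP[iI]; rewrite NE // !inE => sP.
    exists (ev x (Df i m s)); last by rewrite Pt'.
    rewrite map_f // mem_coneA !mem_rcons !inE eqxx iI orbT Im // mn andbT.
    exact: sP.
  - move=> /and4P[iI jI ij tP]; exists (ev x (Df i j t)); last by rewrite Df'.
    by rewrite map_f // mem_coneA !mem_rcons !inE iI jI ij !orbT.
  - by exists (ev x None) => //; rewrite map_f // mem_coneA.
(* Only [z] and differences occur, so one dimension is in excess and contributes the exponent 0. *)
apply: ind_free_perm (G X x' k.+1 ind' _); last by rewrite dX size_rcons addSnnS.
  exact: ev_nonzero_all ind'.
by rewrite /= -(perm_catCA [:: 0%N]).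
Qed.

End Cones.

Arguments ev : simpl never.

(** * Deformations of the Shi arrangement *)

Lemma eq_perm_eq (T : eqType) (s t : seq T) : s = t -> perm_eq s t.
Proof. by move->. Qed.

Section ShiDeformations.
Variables (R : numFieldType) (V : vectType R) (z : 'Hom(V, R^o)) (n : nat).
Implicit Types (I : seq nat) (P Q a d : nat).
Local Notation cone_ind_free := (cone_ind_free z).

Definition shi_points P Q a d (i : nat) : seq int :=
  int_range ((i < P)%N%:Z - a%:Z) (d%:Z + (i < Q)%N%:Z).

(** For [0 < a] the exponent of [i] is the number of points on [x i] plus the number of the other
    indices. *)
Definition shi_exponents I P Q a d : seq nat :=
  [seq (size I + a + d + (i < Q) - (i < P))%N | i <- I] ++ [:: 1%N].

Lemma perm_map_rem (f g : nat -> nat) I i0 b :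
  i0 \in I -> uniq I -> f i0 = b -> {in I, forall i, i != i0 -> f i = g i} ->
  perm_eq ([seq f i | i <- I] ++ [:: 1%N]) (b :: ([seq g i | i <- rem i0 I] ++ [:: 1%N])).
Proof.
move=> i0I uI <- fg; rewrite -cat_cons perm_cat2r.
apply: perm_trans (perm_map f (perm_to_rem i0I)) _ => /=; rewrite perm_cons.
apply/eq_perm_eq/eq_in_map => i; rewrite mem_rem_uniq // inE => /andP[ii iI].
exact: fg.
Qed.

Section FixedIndices.
Variable I : seq nat.
Hypotheses (sI : sorted ltn I) (In : {in I, forall i, (i <= n)%N}).
Hypothesis IH : forall I', (size I' < size I)%N -> sorted ltn I' ->
  {in I', forall i, (i <= n)%N} -> forall P Q a d, (Q <= P)%N -> (0 < a)%N ->
  cone_ind_free I' n (shi_points P Q a d) (shi_exponents I' P Q a d).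

Let uI : uniq I. Proof. exact: (sorted_uniq ltn_trans ltnn). Qed.

Let IHrem i0 P Q a d : i0 \in I -> (Q <= P)%N -> (0 < a)%N ->
  cone_ind_free (rem i0 I) n (shi_points P Q a d) (shi_exponents (rem i0 I) P Q a d).
Proof.
move=> i0I; apply: IH.
- by rewrite size_rem // prednK //; case: (I) i0I.
- by apply: (subseq_sorted ltn_trans (rem_subseq i0 I)).
by move=> i /mem_rem /In.
Qed.

(** If [Q] is an index, the step adds the point [d + 1] to [x Q]. On restriction, smaller indices,
    which already reach [d + 1], gain [d + 2], and larger ones gain [d + 1]: this is the family with
    [d.+1] and the same [Q]. *)
Lemma shi_raise P Q a d : (Q < P)%N -> (0 < a)%N ->
  cone_ind_free I n (shi_points P Q a d) (shi_exponents I P Q a d) ->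
  cone_ind_free I n (shi_points P Q.+1 a d) (shi_exponents I P Q.+1 a d).
Proof.
move=> QP a0 G; have [QI|QI] := boolP (Q \in I); last first.
  have E i : i \in I -> (i < Q.+1)%N = (i < Q)%N.
    by move=> iI; rewrite ltnS leq_eqVlt; case: eqP => // Di; rewrite -Di iI in QI.
  rewrite (_ : shi_exponents I P Q.+1 a d = shi_exponents I P Q a d).
    by apply: eq_cone_ind_free G => i /E iQ s; rewrite /shi_points iQ.
  by congr (_ ++ _); apply/eq_in_map => i /E ->.
have sR : size (rem Q I) = (size I).-1 := size_rem QI; have sP : (0 < size I)%N by case: (I) QI.
apply: cone_ind_free_perm; last first.
  apply: (@cone_ind_free_add_point _ _ _ I n (shi_points P Q a d) _ (shi_points P Q a d.+1) Q d.+1%:Z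
    (size I + a + d).-1 (shi_exponents (rem Q I) P Q a d.+1)) => //.
  - by rewrite mem_int_range ltnn; lia.
  - move=> i iI s; rewrite inE !mem_int_range ltnS; case: (ltngtP i Q) => iQ; lia.
  - move=> i; rewrite mem_rem_uniq // inE => /andP[iQ iI] s.
    rewrite inE !mem_int_range; move: iQ; case: (ltngtP i Q) => // iQ _; lia.
  - apply: cone_ind_free_perm G; apply: (perm_map_rem QI uI).
      by rewrite ltnn QP addn0 subn1.
    by move=> i iI iQ /=; rewrite sR; congr (_ + _ - _)%N; lia.
  exact: IHrem (ltnW QP) a0.
rewrite perm_sym; apply: (perm_map_rem QI uI).
  by rewrite ltnS leqnn QP addn1 subn1 /= prednK //; lia.
by move=> i iI iQ /=; rewrite sR ltnS leq_eqVlt (negPf iQ) /=; congr (_ + _ - _)%N; lia.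
Qed.

(** If [P] is an index, the step adds the point [- a] to [x P]. On restriction, smaller indices gain
    [- a] and larger ones [- a - 1]: this is the family with [a.+1] and the same [P]. *)
Lemma shi_lower P a d : (0 < a)%N ->
  cone_ind_free I n (shi_points P.+1 0 a d) (shi_exponents I P.+1 0 a d) ->
  cone_ind_free I n (shi_points P 0 a d) (shi_exponents I P 0 a d).
Proof.
move=> a0 G; have [PI|PI] := boolP (P \in I); last first.
  have E i : i \in I -> (i < P.+1)%N = (i < P)%N.
    by move=> iI; rewrite ltnS leq_eqVlt; case: eqP => // Di; rewrite -Di iI in PI.
  rewrite (_ : shi_exponents I P 0 a d = shi_exponents I P.+1 0 a d).
    by apply: eq_cone_ind_free G => i /E iP s; rewrite /shi_points iP.
  by congr (_ ++ _); apply/eq_in_map => i /E ->.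
have sR : size (rem P I) = (size I).-1 := size_rem PI; have sP : (0 < size I)%N by case: (I) PI.
apply: cone_ind_free_perm; last first.
  apply: (@cone_ind_free_add_point _ _ _ I n (shi_points P.+1 0 a d) _ (shi_points P 0 a.+1 d) P (- a%:Z)
    (size I + a + d).-1 (shi_exponents (rem P I) P 0 a.+1 d)) => //.
  - by rewrite mem_int_range ltnS leqnn; lia.
  - move=> i iI s; rewrite inE !mem_int_range ltnS; case: (ltngtP i P) => iP; lia.
  - move=> i; rewrite mem_rem_uniq // inE => /andP[iP iI] s.
    rewrite inE !mem_int_range ltnS; move: iP; case: (ltngtP i P) => // iP _; lia.
  - apply: cone_ind_free_perm G; apply: (perm_map_rem PI uI).
      by rewrite ltnS leqnn addn0 subn1.
    move=> i iI iP /=; rewrite sR ltnS [(i <= P)%N]leq_eqVlt (negPf iP) /=.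
    by congr (_ + _ - _)%N; lia.
  exact: IHrem.
rewrite perm_sym; apply: (perm_map_rem PI uI).
  by rewrite ltnn addn0 subn0 /= prednK //; lia.
by move=> i iI iP /=; rewrite sR; congr (_ + _ - _)%N; lia.
Qed.

(** For these parameters 0 is the only point of each coordinate. Without points, the differences
    with the last coordinate [x m] have the points 0 and 1, which is the family with [P = Q = m] on
    the other indices; then the points 0 are added. *)
Lemma shi_origin :
  cone_ind_free I n (shi_points n.+1 0 1 0) (shi_exponents I n.+1 0 1 0).
Proof.
have [->|[I' [m DI]]] : I = [::] \/ exists I' m, I = rcons I' m.
  by case: (lastP I) => [|I' m]; [left|right; exists I', m].
  exact: cone_ind_free_nil.
have I'm : {in I', forall i, (i < m)%N}.
  by move: sI; rewrite DI (sorted_pairwise ltn_trans) pairwise_rcons => /andP[/allP].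
have mn : (m <= n)%N by apply: In; rewrite DI mem_rcons mem_head.
pose N T i : seq int := if (i < T)%N then [:: 0] else [::].
have sIE : size I = (size I').+1 by rewrite DI size_rcons.
(* The points 0 are present for the indices below [T], and their number is the exponent that
   grows. *)
suff G T : cone_ind_free I n (N T) (count (ltn^~ T) I :: nseq (size I').+1.-1 (size I) ++ [:: 1%N]).
  have := G n.+1; rewrite (_ : count _ I = size I); last first.
    by apply/eqP; rewrite -all_count; apply/allP => i /In.
  move=> {}G; rewrite (_ : shi_exponents _ _ _ _ _ = nseq (size I) (size I) ++ [:: 1%N]).
    rewrite {1}sIE; apply: eq_cone_ind_free G => i /In iI s.
    by rewrite /N mem_int_range ltnS iI inE; lia.
  congr (_ ++ _); apply: (@eq_from_nth _ 0%N) => [|i]; rewrite size_map ?size_nseq // => iI.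
  by rewrite (nth_map 0%N) // nth_nseq iI ltnS In ?mem_nth //; lia.
elim: T => [|T IHT].
  rewrite (_ : count _ I = 0)%N; last by apply/eqP; rewrite -leqn0 leqNgt -has_count; apply/hasPn.
  rewrite [in cone_ind_free _]DI; apply: (@cone_ind_free_translate _ _ _ _ _ (shi_points m m 1 0)) => //.
    by move=> i /I'm im s; rewrite mem_int_range im !inE; lia.
  have G' : cone_ind_free I' n (shi_points m m 1 0) (shi_exponents I' m m 1 0).
    apply: IH => //; first by rewrite sIE.
      by move: sI; rewrite DI; apply: (subseq_sorted ltn_trans); exact: subseq_rcons.
    by move=> i iI; apply: In; rewrite DI mem_rcons inE iI orbT.
  apply: cone_ind_free_perm G'.
  rewrite perm_cat2r; apply/eq_perm_eq.
  apply: (@eq_from_nth _ 0%N) => [|i]; rewrite size_map ?size_nseq // => iI.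
  by rewrite (nth_map 0%N) // nth_nseq iI I'm ?mem_nth // sIE; lia.
have [TI|TI] := boolP (T \in I); last first.
  have E i : i \in I -> (i < T.+1)%N = (i < T)%N.
    by move=> iI; rewrite ltnS leq_eqVlt; case: eqP => // Di; rewrite -Di iI in TI.
  rewrite (@eq_in_count _ _ (ltn^~ T)) => [|i /E //].
  by apply: eq_cone_ind_free IHT => i /E iT s; rewrite /N iT.
have -> : count (ltn^~ T.+1) I = (count (ltn^~ T) I).+1.
  rewrite -(@eq_count _ (predU (ltn^~ T) (pred1 T))) => [|i]; last first.
    by rewrite [RHS]ltnS [RHS]leq_eqVlt /= orbC.
  have := count_predUI (ltn^~ T) (pred1 T) I; rewrite count_uniq_mem // TI addn1.
  rewrite (@eq_count _ (predI _ _) pred0) ?count_pred0 ?addn0 // => i /=.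
  by case: eqP => [->|_]; rewrite ?ltnn ?andbF.
(* On [x T = 0] smaller indices have the points 0 and 1, larger ones -1 and 0. *)
apply: (@cone_ind_free_add_point _ _ _ I n (N T) _ (shi_points T T 1 0) T 0) => //.
- by rewrite /N ltnn.
- move=> i iI s; rewrite inE /N ltnS; case: (ltngtP i T) => iT; rewrite ?inE ?orbF //.
- move=> i; rewrite mem_rem_uniq // inE => /andP[iT iI] s.
  by rewrite inE mem_int_range /N; move: iT; case: (ltngtP i T) => // iT _; rewrite ?inE; lia.
rewrite (_ : nseq _ _ ++ _ = shi_exponents (rem T I) T T 1 0); first exact: IHrem.
congr (_ ++ _); apply: (@eq_from_nth _ 0%N) => [|i]; rewrite ?size_map size_nseq size_rem // sIE //.
move=> iI; rewrite nth_nseq iI (nth_map 0%N) ?size_rem ?sIE //=; lia.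
Qed.

Lemma shi_ind_free_step P Q a d : (Q <= P)%N -> (0 < a)%N ->
  cone_ind_free I n (shi_points P Q a d) (shi_exponents I P Q a d).
Proof.
(* Raising [Q] from 0 to [n + 1] moves the upper end for all indices, so it amounts to replacing [d]
   by [d + 1] and [Q] by 0. *)
have G1 e : cone_ind_free I n (shi_points n.+1 0 1 e) (shi_exponents I n.+1 0 1 e).
  elim: e => [|e IHe]; first exact: shi_origin.
  have G Q' : (Q' <= n.+1)%N -> cone_ind_free I n (shi_points n.+1 Q' 1 e) (shi_exponents I n.+1 Q' 1 e).
    by elim: Q' => [//|Q' IHQ] Qn; apply: shi_raise => //; apply: IHQ; apply: ltnW.
  have {}G := G _ (leqnn _).
  rewrite (_ : shi_exponents _ _ _ _ _ = shi_exponents I n.+1 n.+1 1 e).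
    by apply: eq_cone_ind_free G => i /In iI s; rewrite !mem_int_range ltnS iI; lia.
  by congr (_ ++ _); apply/eq_in_map => i /In iI; rewrite ltnS iI; lia.
have lower b e t P' : (0 < b)%N -> cone_ind_free I n (shi_points (P' + t) 0 b e) (shi_exponents I (P' + t) 0 b e) ->
    cone_ind_free I n (shi_points P' 0 b e) (shi_exponents I P' 0 b e).
  move=> b0; elim: t => [|t IHt]; first by rewrite addn0.
  by rewrite addnS => /(shi_lower b0) /IHt.
(* Likewise, lowering [P] from [n + 1] to 0 amounts to raising the parameter [a] by one and
   returning to [P = n + 1]. *)
have G2 b e : cone_ind_free I n (shi_points n.+1 0 b.+1 e) (shi_exponents I n.+1 0 b.+1 e).
  elim: b => [//|b /(lower _ _ n.+1 0%N (ltn0Sn _)) G].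
  rewrite (_ : shi_exponents _ _ _ _ _ = shi_exponents I 0 0 b.+1 e).
    by apply: eq_cone_ind_free G => i /In iI s; rewrite !mem_int_range ltnS iI; lia.
  by congr (_ ++ _); apply/eq_in_map => i /In iI; rewrite ltnS iI; lia.
(* [P] is lowered first, while [Q] is 0 as in [shi_lower], and [Q] is raised afterwards. *)
move=> + a0; elim: Q => [_|Q IHQ QP]; last first.
  by apply: shi_raise => //; apply: IHQ; apply: ltnW.
case: a a0 => // b _; have [Pn|nP] := leqP P n.+1.
  by apply: (lower _ _ (n.+1 - P)%N) => //; rewrite subnKC.
rewrite (_ : shi_exponents _ _ _ _ _ = shi_exponents I n.+1 0 b.+1 d).
  apply: eq_cone_ind_free (G2 b d) => i /In iI s; rewrite !mem_int_range.
  by rewrite (leq_ltn_trans iI (ltnW nP)) ltnS iI.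
by congr (_ ++ _); apply/eq_in_map => i /In iI; rewrite (leq_ltn_trans iI (ltnW nP)) ltnS iI.
Qed.

End FixedIndices.

Lemma shi_ind_free I P Q a d : sorted ltn I -> {in I, forall i, (i <= n)%N} ->
  (Q <= P)%N -> (0 < a)%N -> cone_ind_free I n (shi_points P Q a d) (shi_exponents I P Q a d).
Proof.
move: {2}(size I).+1 (ltnSn (size I)) => k.
elim: k I P Q a d => // k IHk I P Q a d; rewrite ltnS => Ik sI In QP a0.
apply: shi_ind_free_step => // I' I'I sI' I'n P' Q' a' d' QP' a0'.
by apply: IHk => //; apply: leq_trans I'I Ik.
Qed.

End ShiDeformations.

(** * The flag *)

Section ConeArrangement.
Variables (R : realType) (l p k m d : nat).
Hypotheses (hk : (1 <= k <= l)%N) (hp : (p <= l)%N).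
Local Notation V := ('rV[R]_(l + 1) : vectType R).
Local Notation n := (l + 1 - k)%N.

(** * The cone in coordinates *)

Definition dot_product (q : nat) (u v : 'rV[R]_q) : R^o := \sum_(i < q) u 0 i * v 0 i.

Lemma dot_product_is_linear (q : nat) (u : 'rV[R]_q) : linear (dot_product u).
Proof.
move=> a v w; rewrite /dot_product scaler_sumr -big_split.
by apply: eq_bigr => i _; rewrite !mxE mulrDr mulrCA.
Qed.

HB.instance Definition _ (q : nat) (u : 'rV[R]_q) :=
  GRing.isLinear.Build R 'rV[R]_q R^o _ (dot_product u) (dot_product_is_linear u).

Definition xform (i : nat) : 'Hom(V, R^o) :=
  linfun (dot_product (row_mx (coord_form R l i) 0) : V -> R^o).
Definition zform : 'Hom(V, R^o) := linfun (dot_product (row_mx 0 1%:M) : V -> R^o).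

Local Notation evx := (ev zform xform).

Lemma dot_product_row_mx (a b : 'rV[R]_l) (s t : R) :
  dot_product (row_mx a s%:M) (row_mx b t%:M) = \sum_(i < l) a 0 i * b 0 i + s * t.
Proof.
rewrite /dot_product big_split_ord big_ord1 /= !row_mxEr !mxE /= !mulr1n.
by congr (_ + _); apply: eq_bigr => i _; rewrite !row_mxEl.
Qed.

Lemma zformE (b : 'rV[R]_l) t : zform (row_mx b t%:M) = t.
Proof.
rewrite lfunE /= dot_product_row_mx mul1r big1 ?add0r // => i _.
by rewrite mxE mul0r.
Qed.

Lemma xformE (b : 'rV[R]_l) t i :
  xform i (row_mx b t%:M) = \sum_(j < l) coord_form R l i 0 j * b 0 j.
Proof.
rewrite lfunE /= (_ : (0 : 'rV[R]_1) = 0%:M); last by rewrite raddf0.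
by rewrite dot_product_row_mx mul0r addr0.
Qed.

Lemma xform_coord (b : 'rV[R]_l) t (j : 'I_l) : xform j.+1 (row_mx b t%:M) = b 0 j.
Proof.
rewrite xformE (bigD1 j) //= big1 ?addr0 => [|i ij].
  by rewrite mxE eqxx mul1r.
by rewrite mxE eqSS -[(_ == _)]/(i == j) (negPf ij) mul0r.
Qed.

Lemma row_mx_split (v : 'rV[R]_(l + 1)) : v = row_mx (lsubmx v) (rsubmx v 0 0)%:M.
Proof. by rewrite -mx11_scalar hsubmxK. Qed.

Lemma infinity_hyperplaneE : infinity_hyperplane R l = lker (evx None).
Proof.
apply/vspaceP => v; rewrite (row_mx_split v) mem_infinity_hyperplane memv_ker.
by rewrite evE zformE.
Qed.

Lemma cone_hyperplane_point i (s : int) :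
  cone_hyperplane (coord_form R l i, s%:~R) = lker (evx (Pt i s)).
Proof.
apply/vspaceP => v; rewrite (row_mx_split v) mem_cone_hyperplane memv_ker.
by rewrite evE zformE xformE subr_eq0.
Qed.

Lemma cone_hyperplane_difference i j (t : int) :
  cone_hyperplane (coord_form R l i - coord_form R l j, t%:~R) = lker (evx (Df i j t)).
Proof.
apply/vspaceP => v; rewrite (row_mx_split v) mem_cone_hyperplane memv_ker.
rewrite evE zformE !xformE subr_eq0 -sumrB; congr (_ == _); apply: eq_bigr => q _.
by rewrite !mxE mulrBl.
Qed.

(** Here [r] is the number of remaining coordinates. The difference [n - r] is truncated, so the
    upper end is [d] as soon as [r >= n], in particular for the full arrangement. *)
Definition points (r i : nat) : seq int :=
  int_range ((i <= p)%N%:Z - (minn (l - i + 1) k)%:Z - m%:Z) (d + (n - r))%N%:Z.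

Lemma cone_arr_A : cone (arr_A R l p k m d) =
  arr fullv (map evx (coneA (iota 1 l) n (points l))).
Proof.
have nl : (n - l = 0)%N by lia.
congr Arrangement; apply/fsetP => K; apply/fset1UP/mem_arr => [[->|]|].
- exists (evx None); last by rewrite infinity_hyperplaneE capfv.
  by rewrite map_f // mem_coneA.
- move: (mem_coneA (iota 1 l) n (points l)); move: (coneA _ _ _) => cs mem_cs.
  case/imfsetP => h /=; rewrite !mem_cat => hA ->.
  suff [c cI ->] : exists2 c : code_eqType, c \in cs &
      cone_hyperplane h = lker (evx c).
    by exists (evx c); [exact: map_f | rewrite capfv].
  case/or4P: hA => /allpairsPdep[i [j []]]; rewrite !mem_index_iota.
  + move=> il jl ->; exists (Df i j 0); last by rewrite -cone_hyperplane_difference.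
    rewrite mem_cs !mem_iota; lia.
  + move=> il jl ->; exists (Df i j 1); last by rewrite -cone_hyperplane_difference.
    rewrite mem_cs !mem_iota; lia.
  + rewrite mem_int_range => il jl ->; exists (Pt i j); last exact: cone_hyperplane_point.
    rewrite mem_cs mem_iota mem_int_range nl; lia.
  + rewrite mem_int_range => il jl ->; exists (Pt i j); last exact: cone_hyperplane_point.
    rewrite mem_cs mem_iota mem_int_range nl; lia.
move=> [_ /mapP[c + ->] ->]; rewrite capfv mem_coneA.
case: c => [[[i s]|[[i j] t]]|] cI; last by left; rewrite infinity_hyperplaneE.
  right; apply/imfsetP; exists (coord_form R l i, s%:~R) => /=; last first.
    by rewrite cone_hyperplane_point.
  move: cI; rewrite mem_iota mem_int_range nl => cI.
  rewrite !mem_cat; have [ip|ip] := leqP i p.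
    apply/or4P/Or43/allpairsPdep; exists i, s; rewrite mem_index_iota mem_int_range.
    by split=> //; lia.
  apply/or4P/Or44/allpairsPdep; exists i, s; rewrite mem_index_iota mem_int_range.
  by split=> //; lia.
right; apply/imfsetP; exists (coord_form R l i - coord_form R l j, t%:~R) => /=; last first.
  by rewrite cone_hyperplane_difference.
move: cI; rewrite !mem_iota !mem_cat => /and4P[il jl ij /orP[/eqP->|/andP[/eqP-> jn]]].
  apply/or4P/Or41/allpairsPdep; exists i, j; rewrite !mem_index_iota.
  by split=> //; lia.
apply/or4P/Or42/allpairsPdep; exists i, j; rewrite !mem_index_iota.
by split=> //; lia.
Qed.

Definition exponents (r : nat) : seq nat :=
  1%N :: [seq (l + m + d + 1 - (i <= p))%N | i <- iota 1 r].

Lemma sub_int_range a b a' b' : a' <= a -> b <= b' ->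
  {subset int_range a b <= int_range a' b'}.
Proof. by move=> aa bb s; rewrite !mem_int_range; lia. Qed.

(** For [r <= n] all minima equal [k], and this is the Shi family with [P = p + 1], [Q = 0] and
    [a = k + m]. The coordinates beyond [n] are then added one at a time. *)
Lemma points_ind_free r : (r <= l)%N ->
  cone_ind_free zform (iota 1 r) n (points r) (exponents r).
Proof.
have small q : (q <= n)%N -> cone_ind_free zform (iota 1 q) n (points q) (exponents q).
  move=> qn; apply: (@cone_ind_free_perm _ _ _ _ _ _ (shi_exponents (iota 1 q) p.+1 0 (k + m) (d + (n - q)))).
    rewrite /shi_exponents perm_catC; apply/eq_perm_eq; congr (_ :: _).
    apply/eq_in_map => i; rewrite mem_iota size_iota ltnS ltn0 => iq.
    by congr (_ - _)%N; lia.
  apply: (@eq_cone_ind_free _ _ _ _ _ (shi_points p.+1 0 (k + m) (d + (n - q)))) => [i|].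
    rewrite mem_iota => iq s; rewrite !mem_int_range ltnS ltn0.
    have -> : minn (l - i + 1) k = k by lia.
    by congr (_ && _); lia.
  apply: shi_ind_free => //; last by lia.
    exact: iota_ltn_sorted.
  by move=> i; rewrite mem_iota; lia.
have [rn _|nr] := leqP r n; first exact: small.
elim: r nr => // r IHr; rewrite ltnS => nr rl.
have Gr : cone_ind_free zform (iota 1 r) n (points r) (exponents r).
  move: nr; rewrite leq_eqVlt => /predU1P[<-|nr]; first exact: small.
  exact: IHr nr (ltnW rl).
have pE : points r.+1 = points r.
  by rewrite /points (_ : n - r.+1 = n - r)%N //; lia.
rewrite pE -[r.+1]addn1 iotaD cats1 add1n.
(* As [r >= n], the minimum for the index [r.+1] is [l - r], and [r] cancels. *)
have Es : (size (points r r.+1) + size (iota 1 r) = l + m + d + 1 - (r.+1 <= p))%N.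
  rewrite /points /int_range !size_map !size_iota.
  rewrite ifT; last by lia.
  have -> : (n - r = 0)%N by lia.
  case: (r.+1 <= p)%N; lia.
apply: cone_ind_free_perm (cone_ind_free_add_coordinate _ _ _ _ _ Gr).
- rewrite Es /exponents iotaD map_cat /= perm_sym -cat_cons perm_catC /=.
  by rewrite add1n.
- exact: iota_uniq.
- by move=> i; rewrite mem_iota; lia.
- by lia.
- by rewrite map_inj_uniq ?iota_uniq // => a b; lia.
(* For [i <= r] the minimum is at least [l - r + 1], one more than for [r.+1]; this makes up for the
   shift by one when [i <= p < r.+1]. *)
move=> i; rewrite mem_iota => ir; apply: sub_int_range => //.
by case: (leqP r.+1 p); case: (leqP i p); lia.
Qed.

(** * Equations and restrictions of the flag *)

Definition value (j : nat) : int := (d + (n - j))%N%:Z.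

(** For [j < n] the point [value j] exceeds [d], so the equation that fixes [x_j] is not in the
    arrangement; it follows by telescoping from these members. *)
Definition flag_code (j : nat) : code_eqType :=
  if (n <= j)%N then Pt j d%:Z else Df j j.+1 1.

Definition flag_planes (r : nat) : {fset {vspace V}} :=
  [fset lker (evx (flag_code j)) | j in iota r.+1 (l - r)]%fset.

Definition flag (r : nat) : {vspace V} :=
  (fullv :&: \bigcap_(H <- enum_fset (flag_planes r)) H)%VS.

Lemma mem_bigcap_seq (s : seq {vspace V}) v :
  (v \in (\bigcap_(H <- s) H)%VS) = all (fun H : {vspace V} => v \in H) s.
Proof.
by elim: s => [|H s IHs]; rewrite ?big_nil ?memvf // big_cons memv_cap IHs.
Qed.

Lemma mem_flag r (v : V) :
  reflect (forall j, (r < j <= l)%N -> xform j v = (value j)%:~R * zform v) (v \in flag r).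
Proof.
have -> : (v \in flag r) = all (fun j => evx (flag_code j) v == 0) (iota r.+1 (l - r)).
  rewrite /flag capfv mem_bigcap_seq; apply/allP/allP => [vP j jr|vP _ /imfsetP[j /= jr ->]].
    by rewrite -memv_ker; apply: vP; apply/imfsetP; exists j.
  by rewrite memv_ker; apply: vP.
apply: (iffP allP) => vP j jr; last first.
  move: jr; rewrite mem_iota => jr; rewrite evE /flag_code; case: leqP => nj.
    rewrite vP; last by lia.
    by rewrite /value (_ : n - j = 0)%N ?addn0 ?subrr //; lia.
  rewrite !vP; [|lia..]; rewrite -!mulrBl -!rmorphB /= (_ : _ - _ = 0) ?mul0r //.
  by rewrite /value; lia.
have {}vP i : (r < i <= l)%N -> evx (flag_code i) v = 0.
  by move=> ir; apply/eqP/vP; rewrite mem_iota; lia.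
(* The equations are solved from [j = n] downwards, by induction on [n - j]. *)
move: {2}(n - j)%N (leqnn (n - j)) => t; elim: t j jr => [|t IHt] j jr jt.
  have := vP j jr; rewrite /flag_code ifT ?evE; last by lia.
  by move=> /subr0_eq ->; rewrite /value (_ : n - j = 0)%N ?addn0 //; lia.
have [nj|jn] := leqP n j; first by apply: IHt; lia.
have := vP j jr; rewrite /flag_code ifN ?evE -?ltnNge // => /subr0_eq /eqP.
rewrite (IHt j.+1); [|lia..]; rewrite subr_eq => /eqP ->.
rewrite -mulrDl -rmorphD; congr (_%:~R * _); rewrite /value; lia.
Qed.

Lemma flag_last : flag l = fullv.
Proof.
by apply/vspaceP => v; rewrite memvf; apply/mem_flag => j; lia.
Qed.

Lemma flag_subset r : (flag r <= flag r.+1)%VS.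
Proof. by apply/subvP => v /mem_flag vP; apply/mem_flag => j jr; apply: vP; lia. Qed.

Lemma flag_independent r : (r <= l)%N -> independent zform (flag r) xform (iota 1 r).
Proof.
move=> rl c cz; pose b : 'rV[R]_l :=
  \row_(j < l) if (j < r)%N then c j.+1 else (value j.+1)%:~R * cz.
have xE j : (0 < j <= l)%N -> xform j (row_mx b cz%:M) =
    if (j <= r)%N then c j else (value j)%:~R * cz.
  case: j => // j jl; by rewrite (xform_coord _ _ (Ordinal jl)) mxE.
exists (row_mx b cz%:M); last first.
  split; first exact: zformE.
  by move=> i; rewrite mem_iota => ir; rewrite xE ?ifT //; lia.
by apply/mem_flag => j jr; rewrite xE ?ifN ?zformE //; lia.
Qed.

Lemma dim_flag r : (r <= l)%N -> \dim (flag r) = r.+1.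
Proof.
(* Descending induction from [flag l], the whole space; each step imposes one nontrivial
   equation. *)
move=> rl; rewrite -(subKn rl); move: (l - r)%N (leq_subr r l) => t.
elim: t => [_|t IHt tl].
  by rewrite subn0 flag_last dimvf dim_matrix mul1r addn1.
have lt : (l - t = (l - t.+1).+1)%N by lia.
have ind := flag_independent (leq_subr t l).
have nz : ~~ (flag (l - t) <= lker (evx (Pt (l - t)%N (value (l - t)))))%VS.
  apply: (ev_nonzero (n := n) (N := fun i => [:: value i]) ind).
  by rewrite mem_coneA mem_head andbT mem_iota; lia.
have -> : flag (l - t.+1) = (flag (l - t) :&: lker (evx (Pt (l - t)%N (value (l - t)))))%VS.
  apply/vspaceP => v; rewrite memv_cap memv_ker evE subr_eq0.
  apply/mem_flag/andP => [vP|[/mem_flag vP /eqP vt] j jr].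
    by split; [apply/mem_flag => j jr; apply: vP; lia | apply/eqP/vP; lia].
  have [->//|jt] := eqVneq j (l - t)%N; apply: vP; lia.
by apply: succn_inj; rewrite dim_lker_cap // (IHt (ltnW tl)) lt.
Qed.

Lemma flag_in_lattice r : (r <= l)%N -> in_lattice (cone (arr_A R l p k m d)) (flag r).
Proof.
move=> rl; rewrite cone_arr_A; exists (flag_planes r) => //.
apply/fsubsetP => _ /imfsetP[j jr ->]; rewrite /= in jr; apply/mem_arr; exists (evx (flag_code j)); last by rewrite capfv.
move: jr; rewrite mem_iota => jr; rewrite map_f // mem_coneA /flag_code.
case: leqP => nj; rewrite !mem_iota; last by lia.
by rewrite mem_int_range; lia.
Qed.

(** For [i <= r < j] the hyperplane [x_i - x_j = t z] restricts to the point [value j + t] of [x_i],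
    and these points raise the upper end from [d] to exactly [d + (n - r)]. Members that involve no
    coordinate up to [r] contain the flag space or become [z = 0]. *)
Lemma flag_restriction r : (r <= l)%N ->
  restriction (cone (arr_A R l p k m d)) (flag r) =
  arr (flag r) (map evx (coneA (iota 1 r) n (points r))).
Proof.
move=> rl; rewrite cone_arr_A restriction_arr ?subvf //.
have ind := flag_independent rl.
pose rho (c : code_eqType) : code_eqType := match c with
  | None => None
  | Some (inl (i, s)) => if (i <= r)%N then Pt i s else None
  | Some (inr (i, j, t)) => if (j <= r)%N then Df i j t
                            else if (i <= r)%N then Pt i (value j + t) else None
  end.
have None_eq (c : code_eqType) (a : int) :
    ~~ (flag r <= lker (evx c))%VS -> {in flag r, forall v, evx c v = a%:~R * zform v} ->
    (flag r :&: lker (evx c) = flag r :&: lker (evx None))%VS.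
  move=> nz cE; apply: (@lker_cap_eq _ _ _ _ _ a%:~R) => [|v vF].
    rewrite intr_eq0; apply: contraNneq nz => a0; apply/subvP => v /cE.
    by rewrite a0 mul0r memv_ker => ->.
  by rewrite cE // scale_lfunE.
have rhoE c : c \in coneA (iota 1 l) n (points l) -> ~~ (flag r <= lker (evx c))%VS ->
    (flag r :&: lker (evx c) = flag r :&: lker (evx (rho c)))%VS.
  rewrite mem_coneA; case: c => [[[i s]|[[i j] t]]|] //=; rewrite ?mem_iota.
    move=> il nz; case: leqP => [//|ir]; apply: (None_eq _ (value i - s) nz) => v /mem_flag vF.
    rewrite evE vF; last by lia.
    by rewrite intrB mulrBl.
  move=> ijl nz; case: leqP => [//|jr]; case: leqP => ir.
    apply: (@lker_cap_eq _ _ _ _ _ 1) => [|v /mem_flag vF]; first exact: oner_neq0.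
    rewrite scale1r !evE (vF j); last by lia.
    by rewrite intrD mulrDl opprD addrA.
  apply: (None_eq _ (value i - value j - t) nz) => v /mem_flag vF.
  rewrite evE (vF i) ?(vF j); [|lia..].
  by rewrite !intrB !mulrBl.
have rhoI c : c \in coneA (iota 1 l) n (points l) -> rho c \in coneA (iota 1 r) n (points r).
  rewrite !mem_coneA; case: c => [[[i s]|[[i j] t]]|] //=; rewrite ?mem_iota.
    by move=> il; case: leqP => [ir|//]; rewrite !mem_iota; move: il; rewrite !mem_int_range; lia.
  move=> ijl; case: leqP => jr; first by rewrite !mem_iota; lia.
  by case: leqP => [ir|//]; rewrite mem_iota mem_int_range /value; lia.
apply: eq_arr => phi.
  rewrite mem_filter => /andP[+ /mapP[c cI Dphi]]; rewrite {}Dphi => nz.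
  by exists (evx (rho c)); [rewrite map_f ?rhoI | exact: rhoE].
move=> /mapP[c' c'I ->].
suff [c cI cE] : exists2 c, c \in coneA (iota 1 l) n (points l) &
    (flag r :&: lker (evx c) = flag r :&: lker (evx c'))%VS.
  exists (evx c) => //; rewrite mem_filter map_f // andbT sub_lkerE cE -sub_lkerE.
  exact: ev_nonzero ind c'I.
move: c'I; rewrite mem_coneA; case: c' => [[[i s]|[[i j] t]]|].
- rewrite mem_iota mem_int_range => isr; have [sd|ds] := lerP s d%:Z.
    by exists (Pt i s) => //; rewrite mem_coneA mem_iota mem_int_range; lia.
  (* The point [s = d + u + 1] is [value (n - u) + 1], so it comes from a difference with the
     coordinate [n - u] equal to 1. *)
  have [u Du] : exists u : nat, s = d%:Z + u.+1%:Z by exists (absz (s - d%:Z - 1)%R); lia.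
  exists (Df i (n - u)%N 1); first by rewrite mem_coneA !mem_iota; lia.
  apply: (@lker_cap_eq _ _ _ _ _ 1) => [|v /mem_flag vF]; first exact: oner_neq0.
  rewrite scale1r !evE (vF (n - u)%N); last by lia.
  have -> : s = value (n - u) + 1 by rewrite /value; lia.
  by rewrite intrD mulrDl opprD addrA mul1r.
- move=> ijt; exists (Df i j t) => //; rewrite mem_coneA.
  by move: ijt; rewrite !mem_iota; lia.
by exists None.
Qed.

Lemma flag_ind_free r : (r <= l)%N ->
  ind_free (restriction (cone (arr_A R l p k m d)) (flag r)) (exponents r).
Proof.
move=> rl; rewrite flag_restriction // -[exponents r]cats0.
apply: (points_ind_free rl (k := 0%N)); first exact: flag_independent.
by rewrite dim_flag // size_iota addn0.
Qed.

Lemma exponentsE :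
  1%N :: nseq p (l + m + d)%N ++ nseq (l - p)%N (l + m + d + 1)%N = exponents l.
Proof.
rewrite /exponents (_ : iota 1 l = iota 1 p ++ iota (1 + p) (l - p)); last first.
  by rewrite -iotaD subnKC.
rewrite map_cat; congr (_ :: _ ++ _).
  apply: (@eq_from_nth _ 0%N) => [|i]; rewrite size_nseq ?size_map ?size_iota // => ip.
  by rewrite nth_nseq ip (nth_map 0%N) ?size_iota // nth_iota //; lia.
apply: (@eq_from_nth _ 0%N) => [|i]; rewrite size_nseq ?size_map ?size_iota // => ip.
by rewrite nth_nseq ip (nth_map 0%N) ?size_iota // nth_iota //; lia.
Qed.

Lemma exponents_sorted : sorted leq (exponents l).
Proof.
rewrite /= path_sortedE; last exact: leq_trans.
apply/andP; split; first by apply/allP => _ /mapP[i _ ->]; case: (i <= p)%N; lia.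
apply: homo_sorted (iota_ltn_sorted 1 l) => i j ij.
by case: (leqP i p); case: (leqP j p); lia.
Qed.

Lemma take_exponents r : (r <= l)%N -> take r.+1 (exponents l) = exponents r.
Proof. by move=> rl; rewrite /= -map_take take_iota (minn_idPl rl). Qed.

End ConeArrangement.

Theorem theorem7p20 (R : realType) (l p k m d : nat)
    (hk : (1 <= k <= l)%N) (hp : (p <= l)%N) :
  ind_flag_accurate (cone (arr_A R l p k m d))
    (1%N :: nseq p (l + m + d)%N ++ nseq (l - p)%N (l + m + d + 1)%N).
Proof.
rewrite (exponentsE m d hk hp); set A := cone _.
have dimA : \dim (Defs.space A) = l.+1 by rewrite /= dimvf dim_matrix mul1r addn1.
have [indA freeA _] : ind_free A (exponents l p m d l).
  (* The whole arrangement is its own restriction to [flag l], the full space. *)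
  have E := flag_restriction R m d hk hp (leqnn l).
  have := flag_ind_free R m d hk hp (leqnn l); rewrite E (flag_last R d hk hp).
  by rewrite -cone_arr_A.
split=> //; first exact: (exponents_sorted m d hk hp).
(* [flag r] has dimension [r.+1] because of the coordinate [z], whence the shift of the index. *)
exists (fun i => flag R l k d i.-1); rewrite dimA; split; first exact: (flag_last R d hk hp).
  by case=> // i _; apply: (flag_subset R d hk hp).
case=> // r /andP[_]; rewrite ltnS => rl; split=> //.
- exact: flag_in_lattice.
- exact: (dim_flag R d hk hp rl).
- by case: (flag_ind_free R m d hk hp rl).
rewrite take_exponents //; by case: (flag_ind_free R m d hk hp rl).
Qed.
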